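(* Let $p$ be an odd prime, $M=\mathbb Q_p\times\mathbb R$, $\alpha_0\in\mathbb R^\times$ and $y_\alpha\in\mathbb Q_p^\times$. For every $x,\xi\in M$ and $r\in\mathbb Z[1/p]$: (i) $S_J\,\mathcal W(x,\xi)\,S_J^{-1}=\mathcal W(\xi,-x)=\mathcal W(J\cdot(x,\xi))$; (ii) $S_{L_r}\,\mathcal W(x,\xi)\,S_{L_r}^{-1}=\mathcal W(x,\xi+rx)=\mathcal W(L_r\cdot(x,\xi))$; (iii) $S_D\,\mathcal W(x,\xi)\,S_D^{-1}=\mathcal W(px,p^{-1}\xi)=\mathcal W(D\cdot(x,\xi))$.
   Context: $e(t)=e^{2\pi it}$ for $t\in\mathbb R$; $e_p(x)=e^{2\pi i\{x\}_p}$ for $x\in\mathbb Q_p$, where $\{x\}_p\in\mathbb Z[1/p]$ is the $p$-adic fractional part. $\chi(t,\xi)=e_p(t_1\xi_1y_\alpha)\,e(t_2\xi_2/\alpha_0)$ for $t=(t_1,t_2),\xi=(\xi_1,\xi_2)\in M$; the Haar measure on $M$ is normalised to be self-dual with respect to the bicharacter $\chi$. $\mathcal S(M)$ is the Bruhat–Schwartz space. Weyl operators: for $x,\xi\in M$, $\mathcal W(x,\xi)$ is the unitary on $L^2(M)$ given by $(\mathcal W(x,\xi)f)(t)=\chi(t-\tfrac{x}{2},\xi)f(t-x)$. Matrices: $J=\begin{pmatrix}0&1\\-1&0\end{pmatrix}$, $L_r=\begin{pmatrix}1&0\\ r&1\end{pmatrix}$, $D=\begin{pmatrix}p&0\\0&1/p\end{pmatrix}$.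 A matrix $\begin{pmatrix}a&b\\ c&d\end{pmatrix}\in\mathrm{SL}_2(\mathbb Z[1/p])$ acts on $M\times M$ by $(x,\xi)\mapsto(ax+b\xi,cx+d\xi)$, operations being componentwise in $M$. Operators, defined on $\mathcal S(M)$ and extended to unitaries of $L^2(M)$: $(S_Jf)(t)=\int_M\overline{\chi(h,t)}f(h)\,dh$; $(S_{L_r}f)(t)=\chi(t,\tfrac{r}{2}t)f(t)$; $(S_Df)(t_1,t_2)=f(t_1/p,t_2/p)$. *)

(* Defs.v *)
From HB Require Import structures.
From mathcomp Require Import all_boot all_order all_algebra.
From mathcomp Require Import ring_quotient complex.
From mathcomp Require Import all_classical all_reals all_analysis.
From mathcomp Require Import measurable_realfun ring.

Set Implicit Arguments.
Unset Strict Implicit.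
Unset Printing Implicit Defensive.
Import Order.TTheory GRing.Theory Num.Theory.
Import numFieldNormedType.Exports.

Local Open Scope classical_set_scope.
Local Open Scope ring_scope.

(* The p-adic absolute values of integers and rationals, taken in rat rather  *)
(* than in a real field so that Q_p does not depend on one.                   *)
Definition pabsz (p : nat) (a : int) : rat :=
  if a == 0 then 0 else (p%:R ^+ logn p `|a|%N)^-1.

Definition pabsq (p : nat) (x : rat) : rat :=
  pabsz p (numq x) / pabsz p (denq x).

Section pabsq_theory.
Variables (p : nat) (p_prime : prime p).

Let p0 : 0 < p%:R :> rat. Proof. by rewrite ltr0n prime_gt0. Qed.

Lemma pabsz_gt0 a : a != 0 -> 0 < pabsz p a.
Proof. by rewrite /pabsz => /negPf->; rewrite invr_gt0 exprn_gt0. Qed.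

Lemma pabsz_ge0 a : 0 <= pabsz p a.
Proof. by have [->|/pabsz_gt0/ltW//] := eqVneq a 0. Qed.

Lemma pabszM a b : pabsz p (a * b) = pabsz p a * pabsz p b.
Proof.
rewrite /pabsz mulf_eq0.
have [->|a0] := eqVneq a 0; first by rewrite /= mul0r.
have [->|b0] := eqVneq b 0; first by rewrite /= mulr0.
by rewrite /= abszM lognM ?absz_gt0// exprD invfM.
Qed.

Lemma pabszN a : pabsz p (- a) = pabsz p a.
Proof. by rewrite /pabsz oppr_eq0 abszN. Qed.

Lemma pabszD a b : pabsz p (a + b) <= Num.max (pabsz p a) (pabsz p b).
Proof.
have [->|a0] := eqVneq a 0; first by rewrite add0r le_max lexx orbT.
have [->|b0] := eqVneq b 0; first by rewrite addr0 le_max lexx.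
have [ab0|ab0] := eqVneq (a + b) 0.
  by rewrite ab0 [X in X <= _]/pabsz eqxx le_max pabsz_ge0.
rewrite /pabsz (negPf a0) (negPf b0) (negPf ab0).
wlog le_ab : a b a0 b0 ab0 / (logn p `|a|%N <= logn p `|b|%N)%N.
  move=> H; have /orP[|] := leq_total (logn p `|a|%N) (logn p `|b|%N).
    exact: H.
  by rewrite addrC maxC; apply: H => //; rewrite addrC.
rewrite le_max; apply/orP; left.
rewrite lef_pV2 ?posrE ?exprn_gt0// ler_eXn2l ?ltr1n ?prime_gt1//.
rewrite -pfactor_dvdn ?absz_gt0//.
have : (Posz (p ^ logn p `|a|)%N %| a + b)%Z.
  rewrite rpredD// dvdzE/= ?pfactor_dvdnn//.
  exact: dvdn_trans (dvdn_exp2l _ le_ab) (pfactor_dvdnn _ _).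
by rewrite dvdzE.
Qed.

Lemma pabsq_frac (a b : int) : b != 0 ->
  pabsq p (a%:~R / b%:~R) = pabsz p a / pabsz p b.
Proof.
move=> b0; rewrite /pabsq.
set x : rat := a%:~R / b%:~R.
have db : pabsz p (denq x) != 0 by rewrite gt_eqF// pabsz_gt0// denq_eq0.
have bb : pabsz p b != 0 by rewrite gt_eqF// pabsz_gt0.
apply/eqP; rewrite eqr_div// -!pabszM; apply/eqP; congr (pabsz p _).
apply: (@intr_inj rat); rewrite !intrM; apply/eqP.
by rewrite -eqr_div ?intr_eq0 ?denq_eq0// divq_num_den.
Qed.

Lemma pabsq0 : pabsq p 0 = 0.
Proof. by rewrite /pabsq /pabsz mul0r. Qed.

Lemma pabsq1 : pabsq p 1 = 1.
Proof. by rewrite /pabsq /pabsz /= logn1 expr0 invr1 mul1r. Qed.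

Lemma pabsq_ge0 x : 0 <= pabsq p x.
Proof. by rewrite /pabsq mulr_ge0 ?invr_ge0 ?pabsz_ge0. Qed.

Lemma pabsq_gt0 x : (0 < pabsq p x) = (x != 0).
Proof.
have [->|x0] := eqVneq x 0; first by rewrite pabsq0 ltxx.
by rewrite divr_gt0 ?pabsz_gt0 ?numq_eq0 ?denq_eq0.
Qed.

Lemma pabsqM x y : pabsq p (x * y) = pabsq p x * pabsq p y.
Proof.
rewrite -{1}(divq_num_den x) -{1}(divq_num_den y) mulf_div -!intrM.
by rewrite pabsq_frac ?mulf_neq0 ?denq_eq0// !pabszM mulf_div.
Qed.

Lemma pabsqN x : pabsq p (- x) = pabsq p x.
Proof. by rewrite /pabsq numqN denqN pabszN. Qed.

Lemma pabsqV x : pabsq p x^-1 = (pabsq p x)^-1.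
Proof.
have [->|x0] := eqVneq x 0; first by rewrite invr0 pabsq0 invr0.
have px0 : pabsq p x != 0 by rewrite gt_eqF// pabsq_gt0.
by apply: (mulfI px0); rewrite -pabsqM !mulfV// pabsq1.
Qed.

Lemma pabsqD x y : pabsq p (x + y) <= Num.max (pabsq p x) (pabsq p y).
Proof.
rewrite -{1}(divq_num_den x) -{1}(divq_num_den y).
rewrite addf_div ?intr_eq0 ?denq_eq0// -!intrM -intrD.
rewrite pabsq_frac ?mulf_neq0 ?denq_eq0// /pabsq.
have dx : 0 < pabsz p (denq x) by rewrite pabsz_gt0 ?denq_eq0.
have dy : 0 < pabsz p (denq y) by rewrite pabsz_gt0 ?denq_eq0.
rewrite ler_pdivrMr ?pabszM ?mulr_gt0//.
apply: le_trans (pabszD _ _) _; rewrite !pabszM.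
rewrite ge_max; apply/andP; split.
  rewrite -[X in X * _ <= _](divfK (lt0r_neq0 dx)) -[leLHS]mulrA.
  by rewrite ler_pM2r ?mulr_gt0// le_max lexx.
rewrite -[X in X * _ <= _](divfK (lt0r_neq0 dy)) -[leLHS]mulrA [X in _ * X <= _]mulrC.
by rewrite ler_pM2r ?mulr_gt0// le_max lexx orbT.
Qed.

Lemma pabsqB x y : pabsq p (x - y) <= Num.max (pabsq p x) (pabsq p y).
Proof. by rewrite -(pabsqN y) pabsqD. Qed.

Lemma pabsqBC x y : pabsq p (x - y) = pabsq p (y - x).
Proof. by rewrite -opprB pabsqN. Qed.

Lemma pabsqD_lt x y e : pabsq p x < e -> pabsq p y < e -> pabsq p (x + y) < e.
Proof. by move=> xe ye; apply: le_lt_trans (pabsqD _ _) _; rewrite gt_max xe. Qed.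

Lemma pabsqB_lt x y e : pabsq p x < e -> pabsq p y < e -> pabsq p (x - y) < e.
Proof. by move=> xe ye; apply: pabsqD_lt; rewrite ?pabsqN. Qed.

End pabsq_theory.

(* Q_p is the completion of Q for the p-adic absolute value: the ring of      *)
(* Cauchy sequences modulo the ideal of null sequences.                       *)
Definition pcauchy_seq (p : nat) : {pred nat -> rat} := [pred x | `[<
  forall e, 0 < e -> exists N : nat,
    forall m n, (N <= m)%N -> (N <= n)%N -> pabsq p (x m - x n) < e >]].

Record pcauchy (p : nat) (p_prime : prime p) :=
  PCauchy { pcauchy_val :> nat -> rat ; _ : pcauchy_val \in pcauchy_seq p }.

Section pcauchy_ring.
Variables (p : nat) (p_prime : prime p).

Lemma pcauchyP (x : nat -> rat) : reflect
  (forall e, 0 < e -> exists N : nat,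
    forall m n, (N <= m)%N -> (N <= n)%N -> pabsq p (x m - x n) < e)
  (x \in pcauchy_seq p).
Proof. by rewrite inE; exact: asboolP. Qed.

Lemma pcauchy_bounded (x : nat -> rat) : x \in pcauchy_seq p ->
  exists2 B, 0 < B & exists N : nat, forall n, (N <= n)%N -> pabsq p (x n) <= B.
Proof.
move=> /pcauchyP/(_ 1 ltr01)[N xN].
exists (Num.max 1 (pabsq p (x N))); first by rewrite lt_max ltr01.
exists N => n Nn; rewrite -(subrK (x N) (x n)).
apply: le_trans (pabsqD _ _ _) _ => //.
by rewrite ge_max !le_max lexx (ltW (xN _ _ _ _))//= orbT.
Qed.

Lemma pcauchy_subring_closed : subring_closed (pcauchy_seq p).
Proof.
split.
- apply/pcauchyP => e e0; exists 0%N => m n _ _.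
  by rewrite [X in X < _](_ : _ = 0)// -[RHS](pabsq0 p); congr pabsq; rewrite subrr.
- move=> x y /pcauchyP xc /pcauchyP yc; apply/pcauchyP => e e0.
  have [N xN] := xc _ e0; have [M yM] := yc _ e0.
  exists (maxn N M) => m n; rewrite !geq_max => /andP[Nm Mm] /andP[Nn Mn].
  rewrite [X in pabsq _ X](_ : _ = (x m - x n) - (y m - y n)); last first.
    by rewrite /= opprB addrACA opprB [RHS]addrACA; congr (_ + _); rewrite addrC.
  by apply: pabsqB_lt => //; [apply: xN|apply: yM].
- move=> x y xc yc; apply/pcauchyP => e e0.
  have [B B0 [N xB]] := pcauchy_bounded xc.
  have [C C0 [M yC]] := pcauchy_bounded yc.
  have [N' xN] := pcauchyP _ xc _ (divr_gt0 e0 C0).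
  have [M' yM] := pcauchyP _ yc _ (divr_gt0 e0 B0).
  exists (maxn (maxn N M) (maxn N' M')) => m n.
  rewrite !geq_max => /andP[/andP[Nm Mm] /andP[N'm M'm]].
  move=> /andP[/andP[Nn Mn] /andP[N'n M'n]].
  rewrite [X in pabsq _ X](_ : _ = (x m - x n) * y m + x n * (y m - y n));
    last by rewrite mulrBl mulrBr addrA subrK.
  apply: pabsqD_lt => //; rewrite pabsqM//.
    rewrite (@le_lt_trans _ _ (pabsq p (x m - x n) * C))//.
      by rewrite ler_wpM2l ?pabsq_ge0// yC.
    by rewrite -ltr_pdivlMr// xN.
  rewrite (@le_lt_trans _ _ (B * pabsq p (y m - y n)))//.
    by rewrite ler_wpM2r ?pabsq_ge0// xB.
  by rewrite mulrC -ltr_pdivlMr// yM.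
Qed.

HB.instance Definition _ :=
  GRing.isSubringClosed.Build (nat -> rat) (pcauchy_seq p) pcauchy_subring_closed.

HB.instance Definition _ := [isSub for @pcauchy_val p p_prime].
HB.instance Definition _ := [Choice of pcauchy p_prime by <:].
HB.instance Definition _ :=
  [SubChoice_isSubComNzRing of pcauchy p_prime by <:].

Definition pnull : {pred pcauchy p_prime} := [pred x : pcauchy p_prime | `[<
  forall e, 0 < e -> exists N : nat, forall n, (N <= n)%N -> pabsq p (x n) < e >]].

Lemma pnullP (x : pcauchy p_prime) : reflect
  (forall e, 0 < e -> exists N : nat, forall n, (N <= n)%N -> pabsq p (x n) < e)
  (x \in pnull).
Proof. by rewrite inE; exact: asboolP. Qed.

Lemma pnull_idealr_closed : idealr_closed pnull.
Proof.
split.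
- by apply/pnullP => e e0; exists 0%N => n _; rewrite pabsq0.
- apply/negP => /pnullP/(_ 1 ltr01)[N /(_ N (leqnn N))].
  by rewrite pabsq1 ltxx.
- move=> a u v /pnullP un /pnullP vn; apply/pnullP => e e0.
  have [B B0 [N aB]] := pcauchy_bounded (valP a).
  have [M uM] := un _ (divr_gt0 e0 B0); have [K vK] := vn _ e0.
  exists (maxn (maxn N M) K) => n; rewrite !geq_max => /andP[/andP[Nn Mn] Kn].
  apply: pabsqD_lt => //; last exact: vK.
  rewrite pabsqM// (@le_lt_trans _ _ (B * pabsq p (u n)))//.
    by rewrite ler_wpM2r ?pabsq_ge0// aB.
  by rewrite mulrC -ltr_pdivlMr// uM.
Qed.

HB.instance Definition _ := isIdealr.Build _ pnull pnull_idealr_closed.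

End pcauchy_ring.
Arguments pnull {p} p_prime _.
Arguments pcauchyP {p x}.
Arguments pnullP {p p_prime x}.

Definition Qp (p : nat) (p_prime : prime p) : Type :=
  {ideal_quot (pnull p_prime)}.

Section Qp_field.
Variables (p : nat) (p_prime : prime p).
Local Notation Qp := (Qp p_prime).
Local Open Scope quotient_scope.

HB.instance Definition _ := GRing.ComNzRing.on Qp.
HB.instance Definition _ := isPointed.Build Qp 0.

Definition Qp_class (u : pcauchy p_prime) : Qp :=
  \pi_{ideal_quot (pnull p_prime)} u.
Definition Qp_repr (x : Qp) : pcauchy p_prime :=
  repr (x : {ideal_quot (pnull p_prime)}).

Lemma Qp_reprK x : Qp_class (Qp_repr x) = x.
Proof. exact: reprK. Qed.

Lemma Qp_class0 : Qp_class 0 = 0. Proof. exact: rmorph0. Qed.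
Lemma Qp_class1 : Qp_class 1 = 1. Proof. exact: rmorph1. Qed.
Lemma Qp_classD u v : Qp_class (u + v) = Qp_class u + Qp_class v.
Proof. exact: rmorphD. Qed.
Lemma Qp_classB u v : Qp_class (u - v) = Qp_class u - Qp_class v.
Proof. exact: rmorphB. Qed.
Lemma Qp_classM u v : Qp_class (u * v) = Qp_class u * Qp_class v.
Proof. exact: rmorphM. Qed.

Lemma Qp_class_eq u v : (Qp_class u == Qp_class v) = (u - v \in pnull p_prime).
Proof. by rewrite Quotient.idealrBE. Qed.

Lemma Qp_class_eq0 u : (Qp_class u == 0) = (u \in pnull p_prime).
Proof. by rewrite -Qp_class0 Qp_class_eq subr0. Qed.

Lemma pcauchy_nonnull (u : pcauchy p_prime) : u \notin pnull p_prime ->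
  exists2 c, 0 < c & exists N : nat, forall n, (N <= n)%N -> pabsq p (u n) = c.
Proof.
move=> /pnullP/existsNP[e] /not_implyP[e0] /forallNP un.
have [N uN] := pcauchyP (valP u) _ e0.
have /existsNP[m /not_implyP[Nm /negP]] := un N.
rewrite -leNgt => ume; exists (pabsq p (u m)); first exact: lt_le_trans ume.
exists N => n Nn; have unm := uN _ _ Nn Nm.
have lemn : pabsq p (u n) <= pabsq p (u m).
  rewrite -(subrK (u m) (u n)); apply: le_trans (pabsqD _ _ _) _ => //.
  by rewrite ge_max lexx andbT (le_trans (ltW unm)).
apply/eqP; rewrite eq_le lemn/=; rewrite leNgt; apply/negP => ltnm.
have : pabsq p (u m) < pabsq p (u m).
  rewrite -{1}(subrK (u n) (u m)) pabsqD_lt// pabsqBC//.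
  exact: lt_le_trans ume.
by rewrite ltxx.
Qed.

Lemma Qp_inv_ex (x : Qp) : x != 0 -> exists y, y * x = 1.
Proof.
rewrite -(Qp_reprK x); set u := Qp_repr x.
rewrite Qp_class_eq0 => /pcauchy_nonnull[c c0 [N uN]].
have vP : (fun n => (u n)^-1) \in pcauchy_seq p.
  apply/pcauchyP => e e0.
  have [M uM] := pcauchyP (valP u) _ (mulr_gt0 e0 (mulr_gt0 c0 c0)).
  exists (maxn N M) => m n; rewrite !geq_max => /andP[Nm Mm] /andP[Nn Mn].
  have um0 : u m != 0 by rewrite -(pabsq_gt0 p_prime) uN.
  have un0 : u n != 0 by rewrite -(pabsq_gt0 p_prime) uN.
  rewrite [X in pabsq _ X](_ : _ = (u n - u m) / (u m * u n)); last first.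
    by rewrite invfM mulrBl mulrCA (mulrA (u m)) !mulfV// mulr1 mul1r.
  rewrite pabsqM// pabsqV// pabsqM// uN// uN// ltr_pdivrMr ?mulr_gt0//.
  exact: uM.
exists (Qp_class (PCauchy p_prime vP)).
rewrite -Qp_classM -Qp_class1; apply/eqP; rewrite Qp_class_eq.
apply/pnullP => e e0; exists N => n Nn.
rewrite [X in pabsq _ X](_ : _ = (u n)^-1 * u n - 1)//.
by rewrite mulVf ?subrr ?pabsq0// -(pabsq_gt0 p_prime) uN.
Qed.

Definition Qp_inv (x : Qp) : Qp := xget 0 [set y | y * x = 1].

Lemma Qp_mulVf (x : Qp) : x != 0 -> Qp_inv x * x = 1.
Proof. by move=> /Qp_inv_ex[y yx]; rewrite /Qp_inv; case: xgetP => // /(_ y). Qed.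

Lemma Qp_inv0 : Qp_inv 0 = 0.
Proof.
rewrite /Qp_inv; case: xgetP => // y _ /=; rewrite mulr0 => /esym/eqP.
by rewrite oner_eq0.
Qed.

HB.instance Definition _ := GRing.ComNzRing_isField.Build Qp Qp_mulVf Qp_inv0.

(* |x|_p, the limit of |x_n|_p for any Cauchy sequence (x_n) representing x.  *)
Definition pabs (x : Qp) : rat := xget 0 [set c | forall e, 0 < e ->
  exists N : nat, forall n, (N <= n)%N -> `|pabsq p (Qp_repr x n) - c| < e].

Lemma pabsE (x : Qp) c : (forall e, 0 < e -> exists N : nat,
    forall n, (N <= n)%N -> `|pabsq p (Qp_repr x n) - c| < e) ->
  pabs x = c.
Proof.
move=> xc; rewrite /pabs; case: xgetP => [d _ /= xd|/(_ c)/(_ xc)//].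
apply/eqP; rewrite -subr_eq0 -normr_le0; apply/ler_addgt0Pl => e e0.
have e2 : 0 < e / 2 by rewrite divr_gt0.
have [N {}xc] := xc _ e2; have [M {}xd] := xd _ e2.
rewrite addr0 (le_trans (ler_distD (pabsq p (Qp_repr x (maxn N M))) _ _))//.
rewrite (splitr e) lerD ?ltW ?xc ?leq_maxl// distrC.
exact/xd/leq_maxr.
Qed.

Lemma pabs0 : pabs 0 = 0.
Proof.
apply: pabsE => e e0.
have : Qp_repr 0 \in pnull p_prime by rewrite -Qp_class_eq0 Qp_reprK.
move=> /pnullP/(_ e e0)[N xN]; exists N => n Nn.
by rewrite subr0 ger0_norm ?pabsq_ge0 ?xN.
Qed.

Lemma pabs_nonnull (x : Qp) : x != 0 -> 0 < pabs x /\
  exists N : nat, forall n, (N <= n)%N -> pabsq p (Qp_repr x n) = pabs x.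
Proof.
rewrite -{1}(Qp_reprK x) Qp_class_eq0 => /pcauchy_nonnull[c c0 [N xN]].
have -> : pabs x = c.
  by apply: pabsE => e e0; exists N => n /xN->; rewrite subrr normr0.
by split => //; exists N.
Qed.

Lemma pabs_ge0 (x : Qp) : 0 <= pabs x.
Proof.
by have [->|/pabs_nonnull[/ltW]//] := eqVneq x 0; rewrite pabs0.
Qed.

Lemma pabs_eq0 (x : Qp) : pabs x = 0 -> x = 0.
Proof.
by have [//|/pabs_nonnull[+ _] x0] := eqVneq x 0; rewrite x0 ltxx.
Qed.

Lemma pabs_lt (x : Qp) (u : pcauchy p_prime) (e : rat) : 0 < e ->
  Qp_class u = x ->
  pabs x < e <-> exists N : nat, forall n, (N <= n)%N -> pabsq p (u n) < e.
Proof.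
move=> e0 ux.
have xu : Qp_repr x - u \in pnull p_prime.
  by rewrite -Qp_class_eq Qp_reprK ux.
have [M {}xu] := pnullP xu _ e0.
have [x0|x0] := eqVneq x 0.
  rewrite x0 pabs0; split => // _.
  have : u \in pnull p_prime by rewrite -Qp_class_eq0 ux x0.
  by move=> /pnullP/(_ e e0).
have [_ [N xN]] := pabs_nonnull x0; split.
  move=> xe; exists (maxn N M) => n; rewrite geq_max => /andP[Nn Mn].
  rewrite -(subKr (Qp_repr x n) (u n)) pabsqB_lt// ?xN//.
  exact: xu.
move=> [K uK].
pose n := maxn (maxn N M) K.
rewrite -(xN n) ?leq_max ?leqnn// -(subrK (u n) (Qp_repr x n)) pabsqD_lt//.
  by apply: xu; rewrite !leq_max leqnn orbT.
by apply: uK; rewrite !leq_max leqnn orbT.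
Qed.

Lemma pabsD (x y : Qp) : pabs (x + y) <= Num.max (pabs x) (pabs y).
Proof.
rewrite leNgt; apply/negP; rewrite gt_max => /andP[xlt ylt].
have e0 : 0 < pabs (x + y) := le_lt_trans (pabs_ge0 _) xlt.
have [N xN] := (pabs_lt e0 (Qp_reprK x)).1 xlt.
have [M yM] := (pabs_lt e0 (Qp_reprK y)).1 ylt.
have : pabs (x + y) < pabs (x + y).
  apply/(@pabs_lt _ (Qp_repr x + Qp_repr y)) => //.
    by rewrite Qp_classD !Qp_reprK.
  exists (maxn N M) => n; rewrite geq_max => /andP[Nn Mn].
  by rewrite pabsqD_lt ?xN ?yM.
by rewrite ltxx.
Qed.

Lemma pabsN (x : Qp) : pabs (- x) = pabs x.
Proof.
suff le y : pabs (- y) <= pabs y.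
  by apply/eqP; rewrite eq_le le/= -{1}(opprK x) le.
rewrite leNgt; apply/negP => ylt.
have e0 : 0 < pabs (- y) := le_lt_trans (pabs_ge0 _) ylt.
have [N yN] := (pabs_lt e0 (Qp_reprK y)).1 ylt.
have : pabs (- y) < pabs (- y).
  apply/(@pabs_lt _ (0 - Qp_repr y)) => //.
    by rewrite Qp_classB Qp_class0 Qp_reprK sub0r.
  by exists N => n Nn; rewrite sub0r pabsqN ?yN.
by rewrite ltxx.
Qed.

Lemma pdist_xx (x : Qp) : pabs (x - x) = 0.
Proof. by rewrite subrr pabs0. Qed.

Lemma pdist_positivity (x y : Qp) : pabs (x - y) = 0 -> x = y.
Proof. by move=> /pabs_eq0/eqP; rewrite subr_eq0 => /eqP. Qed.

Lemma pdist_sym (x y : Qp) : pabs (x - y) = pabs (y - x).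
Proof. by rewrite -opprB pabsN. Qed.

Lemma pdist_triangle (y x z : Qp) :
  pabs (x - z) <= pabs (x - y) + pabs (y - z).
Proof.
rewrite -(subrKA y); apply: le_trans (pabsD _ _) _.
by rewrite ge_max lerDl lerDr !pabs_ge0.
Qed.

HB.instance Definition _ := isMetric.Build rat Qp
  pdist_xx pdist_positivity pdist_sym pdist_triangle.

End Qp_field.

Definition invp_pred (p : nat) : {pred rat} :=
  [pred q : rat | `[< exists k : nat, q * p%:R ^+ k \is a Num.int >]].

Record Zinvp (p : nat) := MkZinvp {
  zinvp_val :> rat ; _ : zinvp_val \in invp_pred p }.

Section Zinvp_ring.
Variable p : nat.

Lemma invp_subring_closed : subring_closed (invp_pred p).
Proof.
split.
- by apply/asboolP; exists 0%N; rewrite expr0 mulr1 rpred1.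
- move=> x y /asboolP[k xk] /asboolP[l yl]; apply/asboolP; exists (k + l)%N.
  rewrite mulrBl {1}exprD mulrA exprD [X in _ - _ * X]mulrC mulrA.
  by rewrite rpredB// rpredM// rpredX// natr_int.
- move=> x y /asboolP[k xk] /asboolP[l yl]; apply/asboolP; exists (k + l)%N.
  by rewrite exprD mulrACA rpredM.
Qed.

HB.instance Definition _ :=
  GRing.isSubringClosed.Build rat (invp_pred p) invp_subring_closed.
HB.instance Definition _ := [isSub for @zinvp_val p].
HB.instance Definition _ := [Choice of Zinvp p by <:].
HB.instance Definition _ := [SubChoice_isSubComNzRing of Zinvp p by <:].

Lemma invp_invp : p%:R^-1 \in invp_pred p.
Proof.
apply/asboolP; exists 1%N; rewrite expr1.
have [->|p0] := eqVneq (p%:R : rat) 0; first by rewrite mulr0 rpred0.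
by rewrite mulVf// rpred1.
Qed.

Definition zinvp_invp : Zinvp p := MkZinvp invp_invp.

End Zinvp_ring.
Arguments zinvp_invp p : clear implicits.

Section matrices.
Variables (p : nat) (p_prime : prime p).

Definition mx2 (a b c d : Zinvp p) : 'M[Zinvp p]_2 :=
  \matrix_(i, j) (if i == 0 then if j == 0 then a else b
                  else if j == 0 then c else d).

Definition mxJ : 'M[Zinvp p]_2 := mx2 0 1 (-1) 0.
Definition mxL (r : Zinvp p) : 'M[Zinvp p]_2 := mx2 1 0 r 1.
Definition mxD : 'M[Zinvp p]_2 := mx2 p%:R 0 0 (zinvp_invp p).

Lemma det_mx2 a b c d : \det (mx2 a b c d) = a * d - b * c.
Proof.
rewrite (expand_det_row _ ord0) !big_ord_recl big_ord0 /cofactor !det_mx11.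
by rewrite !mxE /= expr0 expr1 mul1r mulN1r mulrN addr0.
Qed.

Lemma det_mxJ : \det mxJ = 1.
Proof. by rewrite det_mx2 mul0r mul1r sub0r opprK. Qed.

Lemma det_mxL r : \det (mxL r) = 1.
Proof. by rewrite det_mx2 mul1r mul0r subr0. Qed.

Lemma det_mxD : \det mxD = 1.
Proof.
rewrite det_mx2 mul0r subr0; apply/val_inj.
rewrite rmorphM rmorph_nat rmorph1 /=.
by rewrite mulfV// pnatr_eq0 -lt0n prime_gt0.
Qed.

End matrices.
Arguments mxJ p : clear implicits.
Arguments mxD p : clear implicits.

(* M = Q_p x R, with the product topology and its Borel sigma-algebra.        *)
Definition QpR (R : realType) (p : nat) (p_prime : prime p) : Type :=
  (Qp p_prime * R)%type.

Section QpR_structures.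
Variables (R : realType) (p : nat) (p_prime : prime p).
Local Notation M := (QpR R p_prime).

HB.instance Definition _ := GRing.Zmodule.copy M (Qp p_prime * R)%type.
HB.instance Definition _ := Topological.copy M (Qp p_prime * R)%type.
HB.instance Definition _ := Pointed.copy M (Qp p_prime * R)%type.
HB.instance Definition _ := Measurable.copy M (g_sigma_algebraType (@open M)).

Definition scaleM (q : rat) (x : M) : M := (ratr q * x.1, ratr q * x.2).

Definition mxact (A : 'M[Zinvp p]_2) (z : M * M) : M * M :=
  (scaleM (val (A 0 0)) z.1 + scaleM (val (A 0 1)) z.2,
   scaleM (val (A 1 0)) z.1 + scaleM (val (A 1 1)) z.2).

End QpR_structures.

Section complex_L2.
Context (d : measure_display) (T : measurableType d) (R : realType).
Variable mu : {measure set T -> \bar R}.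

Definition cmeasurable (f : T -> R[i]) : Prop :=
  measurable_fun setT (fun t => complex.Re (f t)) /\
  measurable_fun setT (fun t => complex.Im (f t)).

Definition cintegral (f : T -> R[i]) : R[i] :=
  Complex (\int[mu]_t complex.Re (f t)) (\int[mu]_t complex.Im (f t)).

Definition sqnormc (z : R[i]) : R := complex.Re z ^+ 2 + complex.Im z ^+ 2.

Definition sqint_pred : {pred T -> R[i]} := [pred f | `[< cmeasurable f /\
  (\int[mu]_t (sqnormc (f t))%:E < +oo)%E >]].

Record sqint := Sqint { sqint_val :> T -> R[i] ; _ : sqint_val \in sqint_pred }.

Lemma sqint_predP (f : T -> R[i]) : reflect
  (cmeasurable f /\ (\int[mu]_t (sqnormc (f t))%:E < +oo)%E) (f \in sqint_pred).
Proof. by rewrite inE; exact: asboolP. Qed.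

Lemma sqnormc_ge0 z : 0 <= sqnormc z.
Proof. by rewrite addr_ge0 ?sqr_ge0. Qed.

Lemma sqnormcM z w : sqnormc (z * w) = sqnormc z * sqnormc w.
Proof. by case: z w => a b [c e]; rewrite /sqnormc /=; ring. Qed.

Lemma sqnormcD z w : sqnormc (z + w) <= 2 * (sqnormc z + sqnormc w).
Proof.
case: z w => a b [c e]; rewrite /sqnormc /= -subr_ge0.
rewrite [leRHS](_ : _ = (a - c) ^+ 2 + (b - e) ^+ 2); last by ring.
by rewrite addr_ge0 ?sqr_ge0.
Qed.

Lemma measurable_sqnormc f : cmeasurable f ->
  measurable_fun setT (fun t => (sqnormc (f t))%:E).
Proof.
move=> [mr mi]; apply/measurable_EFinP/measurable_funD;
  by apply: measurable_funX.
Qed.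

Lemma sqint_submod_closed : submod_closed sqint_pred.
Proof.
split.
  apply/sqint_predP; split; first by split; exact: measurable_cst.
  rewrite integral0_eq ?ltry// => t _.
  by rewrite /sqnormc/= expr0n addr0.
move=> a f g /sqint_predP[[fr fi] f2] /sqint_predP[[gr gi] g2].
have fm := measurable_sqnormc (conj fr fi).
have gm := measurable_sqnormc (conj gr gi).
have sm : cmeasurable (a *: f + g).
  split.
    rewrite [X in measurable_fun _ X](_ : _ = fun t =>
      complex.Re a * complex.Re (f t) - complex.Im a * complex.Im (f t)
      + complex.Re (g t)).
      by apply: measurable_funD => //; apply: measurable_funB;
        apply: measurable_funM.
    apply/funext => t; rewrite -[(a *: f + g) t]/(a * f t + g t).
    by case: a (f t) (g t) => ? ? [? ?] [? ?].
  rewrite [X in measurable_fun _ X](_ : _ = fun t =>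
    complex.Re a * complex.Im (f t) + complex.Im a * complex.Re (f t)
    + complex.Im (g t)).
    by apply: measurable_funD => //; apply: measurable_funD;
      apply: measurable_funM.
  apply/funext => t; rewrite -[(a *: f + g) t]/(a * f t + g t).
  by case: a (f t) (g t) => ? ? [? ?] [? ?].
apply/sqint_predP; split => //.
have a0 : (0 <= (2 * sqnormc a)%:E :> \bar R)%E.
  by rewrite lee_fin mulr_ge0 ?sqnormc_ge0.
have nm0 h t : (0 <= (sqnormc (h t : R[i]))%:E :> \bar R)%E.
  by rewrite lee_fin sqnormc_ge0.
apply: (@le_lt_trans _ _ (\int[mu]_t ((2 * sqnormc a)%R%:E * (sqnormc (f t))%:E
   + 2%R%:E * (sqnormc (g t))%:E))%E).
  apply: ge0_le_integral => //.
  - exact: measurable_sqnormc.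
  - by apply: emeasurable_funD; apply: measurable_funeM.
  - move=> t _; rewrite -!EFinM -EFinD lee_fin.
    rewrite -[(a *: f + g) t]/(a * f t + g t).
    by rewrite (le_trans (sqnormcD _ _))// mulrDr sqnormcM mulrA.
rewrite ge0_integralD//.
- by rewrite !ge0_integralZl// lte_add_pinfty// lte_mul_pinfty.
- by move=> t _; rewrite mule_ge0.
- exact: measurable_funeM.
- by move=> t _; rewrite mule_ge0.
- exact: measurable_funeM.
Qed.

HB.instance Definition _ :=
  GRing.isSubmodClosed.Build R[i] (T -> R[i]) sqint_pred sqint_submod_closed.
HB.instance Definition _ := [isSub for sqint_val].
HB.instance Definition _ := [Choice of sqint by <:].
HB.instance Definition _ := [SubChoice_isSubLmodule of sqint by <:].

Definition aenull : {pred sqint} := [pred f : sqint | `[<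
  {ae mu, forall t, f t = 0} >]].

Lemma aenullP (f : sqint) :
  reflect {ae mu, forall t, f t = 0} (f \in aenull).
Proof. by rewrite inE; exact: asboolP. Qed.

Lemma aenullZD a f g : f \in aenull -> g \in aenull -> a *: f + g \in aenull.
Proof.
move=> /aenullP f0 /aenullP g0; apply/aenullP.
apply: filterS2 f0 g0 => t f0 g0.
by rewrite -[LHS]/(a * f t + g t) f0 g0 mulr0 addr0.
Qed.

Lemma aenull0 : 0 \in aenull.
Proof. by apply/aenullP; apply: filterE. Qed.

Lemma aenull_zmod_closed : zmod_closed aenull.
Proof.
split; first exact: aenull0.
by move=> f g f0 g0; rewrite -scaleN1r addrC aenullZD.
Qed.

HB.instance Definition _ :=
  GRing.isZmodClosed.Build sqint aenull aenull_zmod_closed.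

(* L^2(mu) : square-integrable functions modulo almost everywhere equality.   *)
Definition L2 : Type := {ideal_quot aenull}.
Local Open Scope quotient_scope.

HB.instance Definition _ := GRing.Zmodule.on L2.

Definition L2_class (f : sqint) : L2 := \pi_{ideal_quot aenull} f.
Definition L2_repr (f : L2) : sqint := repr (f : {ideal_quot aenull}).

Lemma L2_reprK f : L2_class (L2_repr f) = f. Proof. exact: reprK. Qed.

Lemma L2_classD f g : L2_class (f + g) = L2_class f + L2_class g.
Proof. exact: raddfD. Qed.

Lemma L2_class_eq f g : (L2_class f == L2_class g) = (f - g \in aenull).
Proof. by rewrite Quotient.idealrBE. Qed.

Definition L2_scale (a : R[i]) (f : L2) : L2 := L2_class (a *: L2_repr f).

Lemma L2_classZ a f : L2_class (a *: f) = L2_scale a (L2_class f).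
Proof.
apply/eqP; rewrite L2_class_eq -scalerBr -[_ *: _]addr0 aenullZD ?aenull0//.
by rewrite -L2_class_eq L2_reprK.
Qed.

Let L2_scaleA a b f : L2_scale a (L2_scale b f) = L2_scale (a * b) f.
Proof. by rewrite -(L2_reprK f) -!L2_classZ scalerA. Qed.

Let L2_scale1 f : L2_scale 1 f = f.
Proof. by rewrite -(L2_reprK f) -!L2_classZ scale1r. Qed.

Let L2_scaleDr : right_distributive L2_scale +%R.
Proof.
move=> a f g; rewrite -(L2_reprK f) -(L2_reprK g).
by rewrite -L2_classD -!L2_classZ scalerDr L2_classD.
Qed.

Let L2_scaleDl f : {morph L2_scale^~ f : a b / a + b}.
Proof.
by move=> a b; rewrite -(L2_reprK f) -!L2_classZ scalerDl L2_classD.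
Qed.

HB.instance Definition _ := GRing.Zmodule_isLmodule.Build R[i] L2
  L2_scaleA L2_scale1 L2_scaleDr L2_scaleDl.

(* The class of a function in L^2(mu), with junk value 0 when the function is *)
(* not measurable and square-integrable.                                      *)
Definition toL2 (f : T -> R[i]) : L2 := L2_class (insubd (0 : sqint) f).

Definition L2_dot (f g : L2) : R[i] :=
  cintegral (fun t => (L2_repr f t)^*%C * L2_repr g t).

Definition unitary_op (U : L2 -> L2) : Prop :=
  [/\ linear U, bijective U & forall f g, L2_dot (U f) (U g) = L2_dot f g].

(* The two-sided inverse when U is bijective; 0 is a default value off the    *)
(* range.                                                                     *)
Definition op_inv (U : L2 -> L2) : L2 -> L2 := 'pinv_(fun=> 0) [set: L2] U.

End complex_L2.

Section characters.
Variables (R : realType) (p : nat) (p_prime : prime p).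
Local Notation M := (QpR R p_prime).
Local Open Scope complex_scope.

Definition expi2pi (t : R) : R[i] := cos (2 * pi * t) +i* sin (2 * pi * t).

(* {x}_p is the unique element of Z[1/p] in [0, 1[ congruent to x mod Z_p.    *)
Definition pfrac (x : Qp p_prime) : rat := xget 0 [set q |
  [/\ q \in invp_pred p, 0 <= q < 1 & pabs (x - ratr q) <= 1]].

Definition expp (x : Qp p_prime) : R[i] := expi2pi (ratr (pfrac x)).

Definition chi (alpha0 : R) (y : Qp p_prime) (t xi : M) : R[i] :=
  expp (t.1 * xi.1 * y) * expi2pi (t.2 * xi.2 / alpha0).

End characters.

Section schwartz_bruhat.
Variables (R : realType) (p : nat) (p_prime : prime p).
Local Notation M := (QpR R p_prime).

Definition schwartz_real (g : R -> R) : Prop := forall n : nat,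
  (forall x, derivable (derive1n n g) x 1) /\
  forall m : nat, exists C : R, forall x, `|x ^+ m * derive1n n g x| <= C.

Definition schwartz_complex (g : R -> R[i]) : Prop :=
  schwartz_real (fun x => complex.Re (g x)) /\
  schwartz_real (fun x => complex.Im (g x)).

Definition locally_constant (phi : Qp p_prime -> R[i]) : Prop :=
  forall x, \forall y \near x, phi y = phi x.

Definition compactly_supported (phi : Qp p_prime -> R[i]) : Prop :=
  compact (closure [set x | phi x != 0]).

(* S(Q_p x R) is the algebraic tensor product of S(Q_p) and S(R).             *)
Definition schwartz_bruhat (f : M -> R[i]) : Prop :=
  exists (n : nat) (phi : 'I_n -> Qp p_prime -> R[i]) (g : 'I_n -> R -> R[i]),
    [/\ forall i, locally_constant (phi i) /\ compactly_supported (phi i),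
        forall i, schwartz_complex (g i) &
        forall t, f t = \sum_(i < n) phi i t.1 * g i t.2].

End schwartz_bruhat.

Section operators.
Variables (R : realType) (p : nat) (p_prime : prime p).
Local Notation M := (QpR R p_prime).
Variables (alpha0 : R) (y : Qp p_prime) (mu : {measure set M -> \bar R}).
Local Notation chi := (chi alpha0 y).

(* Regularity is automatic, M being locally compact and second countable.     *)
Definition haar_measure : Prop :=
  [/\ forall (A : set M) (x : M), measurable A ->
        mu [set x + a | a in A] = mu A,
      forall K : set M, compact K -> (mu K < +oo)%E &
      forall U : set M, open U -> U !=set0 -> (0 < mu U)%E].

Definition funJ (f : M -> R[i]) (t : M) : R[i] :=
  cintegral mu (fun h => (chi h t)^*%C * f h).

Definition funL (r : Zinvp p) (f : M -> R[i]) (t : M) : R[i] :=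
  chi t (scaleM (val r / 2) t) * f t.

Definition funD (f : M -> R[i]) (t : M) : R[i] :=
  f (t.1 / p%:R, t.2 / p%:R).

Definition funW (z : M * M) (f : M -> R[i]) (t : M) : R[i] :=
  chi (t - scaleM (1 / 2) z.1) z.2 * f (t - z.1).

(* mu is self-dual for chi when Fourier inversion holds without a constant.   *)
Definition self_dual : Prop := forall f : M -> R[i], schwartz_bruhat f ->
  forall t, funJ (funJ f) t = f (- t).

(* The class does not depend on the representative, and funW z preserves      *)
(* square-integrability, as mu is translation invariant and |chi| = 1.        *)
Definition weyl (z : M * M) (f : L2 mu) : L2 mu :=
  toL2 mu (funW z (L2_repr f)).

(* U is the unitary operator extending F; it is determined by F because S(M)  *)
(* is dense in L^2(M).                                                        *)
Definition unitary_extension (F : (M -> R[i]) -> M -> R[i])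
    (U : L2 mu -> L2 mu) : Prop :=
  unitary_op U /\
  forall f, schwartz_bruhat f -> U (toL2 mu f) = toL2 mu (F f).

End operators.

(* Main.v *)
(* For each of the three operators S, f |-> S (W z f) and f |-> W z' (S f)    *)
(* are linear isometries of L^2(M), so the f on which they agree form a       *)
(* closed subspace. It contains the functions                                 *)
(* 1_B x g, B compact open in Q_p and g a smooth bump on R: these and their   *)
(* translates and modulations are Bruhat-Schwartz, S is explicit on them, and *)
(* the identity is then a pointwise computation with the bicharacter chi      *)
(* (after a translation of the integral in the case of J). Sets B x ]a, b[    *)
(* form a pi-system generating the Borel sets and 1_]a, b[ is a bounded limit *)
(* of bumps, so the closed subspace is all of L^2(M) by Dynkin's lemma.       *)

Require Import Defs.
From HB Require Import structures.
From mathcomp Require Import all_boot all_order all_algebra.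
From mathcomp Require Import ring_quotient complex.
From mathcomp Require Import all_classical all_reals all_analysis.
From mathcomp Require Import measurable_realfun.
From mathcomp Require Import ring lra.

Set Implicit Arguments.
Unset Strict Implicit.
Unset Printing Implicit Defensive.
Import Order.TTheory GRing.Theory Num.Theory.
Import numFieldNormedType.Exports.

Local Open Scope classical_set_scope.
Local Open Scope ring_scope.

(** Each S is bijective, so S W(z) S^-1 = W(z') amounts to the intertwining relation S W(z) = W(z')
    S; [weyl_conjugation] makes this passage. On explicit functions the relation is a computation
    with phases. For L_r, the chirp q(t) = chi(t, rt/2) satisfies q(t) = q(t - x) chi(t - x/2, rx),
    which is exactly the phase gained when xi becomes xi + rx ([funW_funL]). For D, the scaling
    moves across the bicharacter ([funW_funD]). For J, translating the Fourier integral exchanges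
    translation and modulation, and the half shifts x/2 and xi/2 account for the remaining constants
    ([funW_funJ]).

    Each S is given as a unitary extension from Bruhat-Schwartz functions, so the relation must be
    propagated to L^2(M). It holds on classes of smooth bumps over clopen rectangles
    ([intertwining_bump_rect]), whose images under the Weyl operators are again Bruhat-Schwartz
    ([test_function_funW]). Both sides are linear isometries, so the set where they agree is a
    closed subspace ([isometry_equalizer_closed]); bumps converge to indicators of rectangles, and
    Dynkin's lemma then shows that this subspace is everything ([dominated_density]).

    The supporting facts are these: e_p is a character because an element of Z[1/p] lying in Z_p is
    an integer ([invp_int]); balls of Q_p are clopen and compact ([Qp_compact_ball]); exp(-1/x)
    extends smoothly by 0 ([is_derive_flat]); translation invariance of [mu] makes W(z) an isometry
    that can be computed on any representative ([weyl_toL2]). *)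

(** * Rational approximation and fractional parts in Q_p *)

Section rationals_in_Qp.
Variables (p : nat) (p_prime : prime p).
Local Notation Qp := (Qp p_prime).
Implicit Types (x y : Qp) (a b q : rat).

Lemma const_pcauchy q : (fun=> q) \in pcauchy_seq p.
Proof.
by apply/pcauchyP => e e0; exists 0%N => m n _ _; rewrite subrr pabsq0.
Qed.

(** The embedding by constant sequences is a ring morphism directly from the quotient construction;
    the algebraic laws of [ratr] into [Qp] are transported from it. *)
Definition Qp_const q : Qp := Qp_class (PCauchy p_prime (const_pcauchy q)).

Let Qp_constB : additive Qp_const.
Proof. by move=> a b; rewrite /Qp_const -Qp_classB; congr Qp_class; apply/val_inj. Qed.

Let Qp_constM : multiplicative Qp_const.
Proof.
split=> [a b|]; first by rewrite /Qp_const -Qp_classM; congr Qp_class; apply/val_inj.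
by rewrite /Qp_const -Qp_class1; congr Qp_class; apply/val_inj.
Qed.

HB.instance Definition _ := GRing.isAdditive.Build rat Qp Qp_const Qp_constB.
HB.instance Definition _ := GRing.isMultiplicative.Build rat Qp Qp_const Qp_constM.

Lemma ratr_Qp_const q : ratr q = Qp_const q.
Proof.
rewrite -[in RHS](divq_num_den q) fmorph_div !rmorph_int.
by rewrite /ratr.
Qed.

Lemma ratr_QpD a b : ratr (a + b) = ratr a + ratr b :> Qp.
Proof. by rewrite !ratr_Qp_const rmorphD. Qed.
Lemma ratr_QpB a b : ratr (a - b) = ratr a - ratr b :> Qp.
Proof. by rewrite !ratr_Qp_const rmorphB. Qed.
Lemma ratr_QpN a : ratr (- a) = - ratr a :> Qp.
Proof. by rewrite !ratr_Qp_const rmorphN. Qed.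
Lemma ratr_QpM a b : ratr (a * b) = ratr a * ratr b :> Qp.
Proof. by rewrite !ratr_Qp_const rmorphM. Qed.
Lemma ratr_QpV a : ratr a^-1 = (ratr a)^-1 :> Qp.
Proof. by rewrite !ratr_Qp_const fmorphV. Qed.
Lemma ratr_Qp0 : ratr 0 = 0 :> Qp.
Proof. by rewrite !ratr_Qp_const rmorph0. Qed.
Lemma ratr_Qp1 : ratr 1 = 1 :> Qp.
Proof. by rewrite !ratr_Qp_const rmorph1. Qed.
Lemma ratr_Qp_nat n : ratr n%:R = n%:R :> Qp.
Proof. by rewrite !ratr_Qp_const rmorph_nat. Qed.

Lemma eq_lt_gt0 (c d : rat) : 0 <= c -> 0 <= d ->
  (forall e, 0 < e -> (c < e) = (d < e)) -> c = d.
Proof.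
move=> c0 d0 cd; apply/eqP; rewrite eq_le !leNgt; apply/andP; split; apply/negP => lt.
  by have := cd _ (le_lt_trans d0 lt); rewrite ltxx lt.
by have := cd _ (le_lt_trans c0 lt); rewrite ltxx lt.
Qed.

(** [pabs] is defined through a chosen representative. By [pabs_lt] its strict upper bounds can be
    tested on any representative, and they determine a nonnegative number. *)
Lemma pabs_eventually x (u : pcauchy p_prime) (c : rat) : Qp_class u = x ->
  (exists N : nat, forall n, (N <= n)%N -> pabsq p (u n) = c) -> pabs x = c.
Proof.
move=> ux [N uN].
apply: eq_lt_gt0; [exact: pabs_ge0|by rewrite -(uN N)// pabsq_ge0|].
move=> e e0; apply/idP/idP => [/(pabs_lt e0 ux)[M uM]|ce].
  by rewrite -(uN (maxn N M)) ?leq_maxl// uM ?leq_maxr.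
by apply/(pabs_lt e0 ux); exists N => n /uN->.
Qed.

Lemma pabs_ratr q : pabs (ratr q : Qp) = pabsq p q.
Proof.
by apply: (@pabs_eventually _ (PCauchy p_prime (const_pcauchy q)));
  [rewrite ratr_Qp_const|exists 0%N].
Qed.

Lemma pabsM x y : pabs (x * y) = pabs x * pabs y.
Proof.
have [->|x0] := eqVneq x 0; first by rewrite mul0r pabs0 mul0r.
have [->|y0] := eqVneq y 0; first by rewrite mulr0 pabs0 mulr0.
have [_ [N xN]] := pabs_nonnull x0; have [_ [M yM]] := pabs_nonnull y0.
apply: (@pabs_eventually _ (Qp_repr x * Qp_repr y)).
  by rewrite Qp_classM !Qp_reprK.
exists (maxn N M) => n; rewrite geq_max => /andP[Nn Mn].
by rewrite -(xN n)// -(yM n)// -pabsqM.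
Qed.

Lemma pabsB x y : pabs (x - y) <= Num.max (pabs x) (pabs y).
Proof. by rewrite -(pabsN y) pabsD. Qed.

Lemma pabsD_le x y c : pabs x <= c -> pabs y <= c -> pabs (x + y) <= c.
Proof. by move=> xc yc; apply: le_trans (pabsD _ _) _; rewrite ge_max xc. Qed.

Lemma pabsB_le x y c : pabs x <= c -> pabs y <= c -> pabs (x - y) <= c.
Proof. by move=> xc yc; apply: pabsD_le; rewrite ?pabsN. Qed.

Lemma Qp_approx x e : 0 < e -> exists q : rat, pabs (x - ratr q) < e.
Proof.
move=> e0; have [N xN] := pcauchyP (valP (Qp_repr x)) _ e0.
exists (Qp_repr x N); set q := Qp_repr x N.
apply/(@pabs_lt _ _ _ (Qp_repr x - PCauchy p_prime (const_pcauchy q))) => //.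
  by rewrite Qp_classB Qp_reprK ratr_Qp_const.
by exists N => n Nn; exact: xN.
Qed.

Let p_gt0 n : 0 < p%:R ^+ n :> rat.
Proof. by rewrite exprn_gt0// ltr0n prime_gt0. Qed.

Lemma pabsz_le n (a : int) :
  (pabsz p a <= (p%:R ^+ n)^-1) = ((p ^ n)%N%:Z %| a)%Z.
Proof.
rewrite /pabsz dvdzE /=; have [->|a0] := eqVneq a 0.
  by rewrite absz0 dvdn0 invr_ge0 ltW.
by rewrite lef_pV2 ?posrE// ler_eXn2l ?ltr1n ?prime_gt1// pfactor_dvdn ?absz_gt0.
Qed.

Lemma pabsz_int_le1 (a : int) : pabsz p a <= 1.
Proof. by have := pabsz_le 0 a; rewrite expr0 invr1 => ->; rewrite dvd1z. Qed.

Lemma pabsq_int (a : int) : pabsq p a%:~R = pabsz p a.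
Proof.
have := @pabsq_frac p p_prime a 1 isT; rewrite divr1 => ->.
by rewrite /pabsz/= logn1 expr0 !invr1 mulr1.
Qed.

Lemma pabsq_pX n : pabsq p (p%:R ^+ n) = (p%:R ^+ n)^-1.
Proof.
rewrite -natrX pmulrn pabsq_int /pabsz.
by rewrite eqz_nat -[_ == 0]negbK -lt0n expn_gt0 prime_gt0//= pfactorK// -natrX pmulrn.
Qed.

(** The denominator of v is prime to p, hence invertible modulo p^n, so v is congruent to an integer
    modulo p^n. *)
Lemma pabsq_le1_approx v n : pabsq p v <= 1 ->
  exists2 a : nat, (a < p ^ n)%N & pabsq p (v - a%:R) <= (p%:R ^+ n)^-1.
Proof.
have d0 : denq v != 0 := denq_neq0 v.
have pd0 : 0 < pabsz p (denq v) by apply: pabsz_gt0.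
rewrite {1}/pabsq ler_pdivrMr// mul1r => nd.
(* If p divided the denominator, |num| <= |den| <= 1/p would make p divide the numerator too,
   against lowest terms. *)
have pd : coprime p `|denq v|.
  rewrite prime_coprime//; apply/negP => pd.
  have := coprime_num_den v; have : (p %| `|numq v|)%N.
    have : ((p ^ 1)%N%:Z %| numq v)%Z.
      rewrite -pabsz_le (le_trans nd)// pabsz_le dvdzE/= expn1//.
    by rewrite dvdzE/= expn1.
  move=> pn; rewrite /coprime => /eqP cop.
  have : (p %| 1)%N by rewrite -cop dvdn_gcd pn pd.
  by rewrite dvdn1 => /eqP p1; move: p_prime; rewrite p1.
have {}pd1 : pabsz p (denq v) = 1.
  apply/eqP; rewrite eq_le pabsz_int_le1/=.
  rewrite /pabsz (negPf d0) -[logn _ _]/(logn _ _) invf_ge1 ?p_gt0//.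
  by rewrite logn_coprime ?expr0.
have cop : coprimez (denq v) (p ^ n)%N%:Z.
  by rewrite coprimezE coprime_sym/= coprimeXl.
(* The Bezout coefficient [s] inverts the denominator modulo p^n; the witness is the residue of
   [numq v * s]. *)
have /coprimezP[[s t] /= st] := cop.
pose a := ((numq v * s) %% (p ^ n)%N%:Z)%Z.
have pn0 : (p ^ n)%N%:Z != 0 :> int by rewrite eqz_nat -lt0n expn_gt0 prime_gt0.
have a0 : 0 <= a by rewrite modz_ge0.
have an : (`|a| < p ^ n)%N.
  by rewrite -ltz_nat gez0_abs// ltz_mod.
exists `|a|%N => //.
have -> : v - `|a|%:R = (numq v - a * denq v)%:~R / (denq v)%:~R :> rat.
  rewrite intrB intrM mulrBl mulfK ?intr_eq0// divq_num_den.
  by rewrite -[in RHS](gez0_abs a0) -pmulrn.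
rewrite pabsq_frac// pd1 divr1 pabsz_le.
have -> : numq v - a * denq v =
    (numq v * t + (numq v * s %/ (p ^ n)%N%:Z)%Z * denq v) * (p ^ n)%N%:Z.
  have aE : a = numq v * s - (numq v * s %/ (p ^ n)%N%:Z)%Z * (p ^ n)%N%:Z.
    by apply/eqP; rewrite eq_sym subr_eq [X in _ == X]addrC -divz_eq.
  rewrite aE -[X in X - _]mulr1 -st; ring.
by rewrite dvdz_mull.
Qed.

(** Multiplying by p^k reduces to [pabsq_le1_approx] at precision n + k. The finiteness of the set
    of centres gives total boundedness in [Qp_compact_ball0]; n = 0 gives fractional parts in
    [pfracP]. *)
Lemma Qp_approx_frac x k n : pabs x <= p%:R ^+ k ->
  exists2 a : nat, (a < p ^ (n + k))%N &
    pabs (x - ratr (a%:R / p%:R ^+ k)) <= (p%:R ^+ n)^-1.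
Proof.
move=> xk.
have pn0 : 0 < (p%:R ^+ n)^-1 :> rat by rewrite invr_gt0.
have [q xq] := Qp_approx x pn0.
have qk : pabsq p q <= p%:R ^+ k.
  rewrite -pabs_ratr -(subKr x (ratr q)) pabsB_le//.
  rewrite (le_trans (ltW xq))// (@le_trans _ _ 1)//.
    by rewrite invf_le1// exprn_ege1// ler1n prime_gt0.
  by rewrite exprn_ege1// ler1n prime_gt0.
have pk0 := p_gt0 k.
have [|a ank aq] := @pabsq_le1_approx (q * p%:R ^+ k) (n + k).
  by rewrite pabsqM// pabsq_pX ler_pdivrMr// mul1r.
exists a => //.
rewrite -(subrKA (ratr q)) pabsD_le ?(ltW xq)// -ratr_QpB pabs_ratr.
have -> : q - a%:R / p%:R ^+ k = (q * p%:R ^+ k - a%:R) * (p%:R ^+ k)^-1.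
  by rewrite mulrBl mulfK// gt_eqF.
rewrite pabsqM// pabsqV// pabsq_pX invrK -ler_pdivlMr//.
by rewrite -invfM -exprD.
Qed.

Lemma Qp_pabs_bound x : exists k : nat, pabs x <= p%:R ^+ k.
Proof.
have := archi_boundP (pabs_ge0 x); set n := Num.Def.archi_bound _ => xn.
exists n; rewrite (le_trans (ltW xn))// -natrX ler_nat ltnW// ltn_expl//.
exact: prime_gt1.
Qed.

(** A numerator c over p^k has absolute value at most 1 only if p^k divides c. This is why a
    fractional part is determined modulo 1. *)
Lemma invp_int q : q \in invp_pred p -> pabsq p q <= 1 -> q \is a Num.int.
Proof.
move=> /asboolP[k /intrP[c qc]] q1.
have pk0 := p_gt0 k.
have qE : q = c%:~R / p%:R ^+ k by rewrite -qc mulfK// gt_eqF.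
have : ((p ^ k)%N%:Z %| c)%Z.
  rewrite -pabsz_le -pabsq_int -qc pabsqM// pabsq_pX.
  by rewrite ler_pdivrMr// mulVf ?gt_eqF.
move=> /dvdzP[d cd]; rewrite qE cd intrM -pmulrn natrX mulfK ?gt_eqF//.
Qed.

(** Existence comes from [Qp_approx_frac] at precision 1: the bound a < p^k puts a / p^k in [0, 1[,
    so the default value of [xget] is never taken. *)
Lemma pfracP x : [/\ pfrac x \in invp_pred p, 0 <= pfrac x < 1
  & pabs (x - ratr (pfrac x)) <= 1].
Proof.
rewrite /pfrac; case: xgetP => [q _ //|]; have [k xk] := Qp_pabs_bound x.
have [a ak xa] := Qp_approx_frac 0 xk.
have pk0 := p_gt0 k.
move=> /(_ (a%:R / p%:R ^+ k)) []; split.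
- by apply/asboolP; exists k; rewrite divfK ?gt_eqF// intr_nat.
- by rewrite divr_ge0 ?ler0n ?(ltW pk0)//= ltr_pdivrMr// mul1r -natrX ltr_nat.
- by rewrite expr0 invr1 in xa.
Qed.
End rationals_in_Qp.

(** * The characters e and e_p, and the bicharacter chi *)

Section additive_characters.
Variables (R : realType) (p : nat) (p_prime : prime p).
Local Notation Qp := (Qp p_prime).
Local Notation M := (QpR R p_prime).
Local Open Scope complex_scope.

Lemma expi2piD (s t : R) : expi2pi (s + t) = expi2pi s * expi2pi t.
Proof.
rewrite /expi2pi mulrDr cosD sinD; apply/eqP; rewrite eq_complex /=.
by rewrite eqxx/= addrC.
Qed.

Lemma expi2pi0 : expi2pi (0 : R) = 1.
Proof. by rewrite /expi2pi mulr0 cos0 sin0. Qed.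

Lemma expi2pi_nat n : expi2pi (n%:R : R) = 1.
Proof.
elim: n => [|n IHn]; first exact: expi2pi0.
by rewrite -natr1 expi2piD IHn mul1r /expi2pi mulr1 mulrC mulr_natr cos2pi sin2pi.
Qed.

Lemma expi2pi_int (a : int) : expi2pi (a%:~R : R) = 1.
Proof.
case: a => n; first by rewrite -pmulrn expi2pi_nat.
rewrite NegzE intrN -pmulrn.
by rewrite -[LHS]mulr1 -[in X in _ * X](expi2pi_nat n.+1) -expi2piD addNr expi2pi0.
Qed.

Lemma conjcM (z w : R[i]) : (z * w)^*%C = z^*%C * w^*%C.
Proof.
case: z w => a b [c d]; apply/eqP; rewrite eq_complex/=.
by rewrite mulrNN eqxx/= mulrN mulNr opprD.
Qed.

Lemma expi2pi_conj (t : R) : (expi2pi t)^*%C = expi2pi (- t).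
Proof. by rewrite /expi2pi mulrN cosN sinN. Qed.

(** Two elements of Z[1/p] congruent to x modulo Z_p differ by an integer, which e sends to 1. Being
    free to choose q makes additivity and conjugation of e_p immediate, without tracking carries in
    {x}_p. *)
Lemma expp_eq (x : Qp) (q : rat) : q \in invp_pred p ->
  pabs (x - ratr q) <= 1 -> expp R x = expi2pi (ratr q).
Proof.
move=> qp xq; have [fp _ xf] := pfracP x.
have /intrP[a qa] : q - pfrac x \in Num.int.
  apply: (@invp_int p p_prime); first by rewrite rpredB.
  rewrite -(pabs_ratr p_prime) ratr_QpB.
  rewrite (_ : _ - _ = (x - ratr (pfrac x)) - (x - ratr q)); first exact: (pabsB_le xf xq).
  by rewrite opprB [RHS]addrC subrKA.
rewrite /expp -(subrK (pfrac x) q) qa rmorphD/= expi2piD ratr_int.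
by rewrite expi2pi_int mul1r.
Qed.

Lemma exppD (x y : Qp) : expp R (x + y) = expp R x * expp R y.
Proof.
have [fx _ xf] := pfracP x; have [fy _ yf] := pfracP y.
rewrite (@expp_eq _ (pfrac x + pfrac y)); first by rewrite rmorphD expi2piD.
  exact: rpredD.
by rewrite ratr_QpD opprD addrACA; exact: (pabsD_le xf yf).
Qed.

Lemma expp_le1 (x : Qp) : pabs x <= 1 -> expp R x = 1.
Proof.
move=> x1; rewrite (@expp_eq _ 0); [by rewrite rmorph0 expi2pi0|exact: rpred0|].
by rewrite ratr_Qp0 subr0; exact: x1.
Qed.

Lemma expp0 : expp R (0 : Qp) = 1.
Proof. by rewrite expp_le1 ?pabs0. Qed.

Lemma expp_conj (x : Qp) : (expp R x)^*%C = expp R (- x).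
Proof.
have [fx _ xf] := pfracP x.
rewrite (@expp_eq (- x) (- pfrac x)).
- by rewrite expi2pi_conj rmorphN.
- by rewrite rpredN; exact: fx.
- by rewrite ratr_QpN -opprD pabsN; exact: xf.
Qed.

Lemma sqnormc_expi2pi (t : R) : sqnormc (expi2pi t) = 1.
Proof. by rewrite /sqnormc/= cos2Dsin2. Qed.

Section chi.
Variables (alpha0 : R) (y : Qp).
Implicit Types s t z : M.
Local Notation chi := (chi alpha0 y).

Lemma chiDl s t z : chi (s + t) z = chi s z * chi t z.
Proof.
rewrite /chi/= !mulrDl exppD expi2piD; ring.
Qed.

Lemma chiC s t : chi s t = chi t s.
Proof. by rewrite /chi [s.1 * _]mulrC [s.2 * _]mulrC. Qed.

Lemma chiDr s t z : chi z (s + t) = chi z s * chi z t.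
Proof. by rewrite !(chiC z) chiDl. Qed.

Lemma chi0l s : chi 0 s = 1.
Proof. by rewrite /chi/= !mul0r expp0 expi2pi0 mul1r. Qed.

Lemma chi_conj s t : (chi s t)^*%C = chi (- s) t.
Proof. by rewrite /chi conjcM expp_conj expi2pi_conj !mulNr. Qed.

Lemma chiNr s t : chi s (- t) = chi (- s) t.
Proof. by rewrite /chi/= !mulNr !mulrN !mulNr. Qed.

Lemma sqnormc_chi s t : sqnormc (chi s t) = 1.
Proof. by rewrite /chi sqnormcM /expp !sqnormc_expi2pi mulr1. Qed.

Lemma chiZ q s t : chi (scaleM q s) t = chi s (scaleM q t).
Proof. by rewrite /chi/= (mulrC _ s.1) (mulrC _ s.2) -!mulrA. Qed.

End chi.
End additive_characters.

(** * The ultrametric topology of Q_p *)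

Section Qp_topology.
Variables (p : nat) (p_prime : prime p).
Local Notation Qp := (Qp p_prime).
Implicit Types (x y z a : Qp) (e : rat).

Lemma Qp_ballE x e y : ball x e y = (pabs (x - y) < e) :> Prop.
Proof. by []. Qed.

Lemma pabsD_lt x y e : pabs x < e -> pabs y < e -> pabs (x + y) < e.
Proof.
move=> xe ye; apply: le_lt_trans (pabsD _ _) _; rewrite gt_max.
by apply/andP; split.
Qed.

Lemma Qp_ball_trans x y z e : ball x e y -> ball y e z -> ball x e z.
Proof.
rewrite !Qp_ballE => xy yz; rewrite -(subrKA y); exact: (pabsD_lt xy yz).
Qed.

Lemma Qp_open_ball x e : 0 < e -> open (ball x e).
Proof.
move=> e0; rewrite openE => y xy; apply/nbhs_ballP; exists e => // z yz.
exact: (Qp_ball_trans xy yz).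
Qed.

Lemma Qp_closed_ball x e : 0 < e -> closed (ball x e).
Proof.
move=> e0; rewrite -openC openE => y xy; apply/nbhs_ballP; exists e => // z yz xz.
by apply: xy; apply: (Qp_ball_trans xz); apply: ball_sym; exact: yz.
Qed.

(** The limit is the class of the sequence itself. If some distance to it exceeded [r n], the bound
    on later terms would make that distance smaller than itself through [pabs_lt]. *)
Lemma Qp_cauchy_lim (q : nat -> rat) (r : nat -> rat) :
  (forall e, 0 < e -> exists N, forall n, (N <= n)%N -> r n < e) ->
  (forall m n, (m <= n)%N -> pabsq p (q n - q m) <= r m) ->
  exists x, forall n, pabs (x - ratr (q n)) <= r n.
Proof.
move=> r0 qr.
have qc : q \in pcauchy_seq p.
  apply/pcauchyP => e e0; have [N rN] := r0 _ e0; exists N => m n Nm Nn.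
  rewrite -(subrKA (q N)); apply: pabsqD_lt => //.
    exact: le_lt_trans (qr _ _ Nm) (rN _ (leqnn _)).
  rewrite pabsqBC//; exact: le_lt_trans (qr _ _ Nn) (rN _ (leqnn _)).
exists (Qp_class (PCauchy p_prime qc)) => n; rewrite leNgt; apply/negP => rlt.
set x := Qp_class _ in rlt.
have e0 : 0 < pabs (x - ratr (q n)).
  by apply: le_lt_trans rlt; rewrite (le_trans _ (qr n n (leqnn _)))// pabsq_ge0.
have : pabs (x - ratr (q n)) < pabs (x - ratr (q n)).
  have ux : Qp_class (PCauchy p_prime qc - PCauchy p_prime (const_pcauchy p (q n)))
      = x - ratr (q n) by rewrite Qp_classB ratr_Qp_const.
  apply/(pabs_lt e0 ux); exists n => m nm; apply: le_lt_trans rlt; exact: qr.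
by rewrite ltxx.
Qed.

Lemma invr_pX_small e : 0 < e -> exists N, forall n, (N <= n)%N -> (p%:R ^+ n)^-1 < e.
Proof.
move=> e0; have := archi_boundP (ltW (divr_gt0 (@ltr01 rat) e0)).
set N := Num.Def.archi_bound _ => eN; exists N => n Nn.
rewrite -[e]invrK ltf_pV2 ?posrE ?invr_gt0 ?exprn_gt0 ?ltr0n ?prime_gt0//.
rewrite mul1r in eN; rewrite (lt_trans eN)// -natrX ltr_nat.
by rewrite (leq_ltn_trans Nn)// ltn_expl// prime_gt1.
Qed.

(* A total boundedness argument: an ultrafilter selects one ball of each      *)
(* radius p^-n, and the centres form a Cauchy sequence of rationals.          *)
Lemma Qp_compact_ball0 k : compact [set x : Qp | pabs x <= p%:R ^+ k].
Proof.
rewrite compact_ultra => F FU Fk.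
have Fn n : exists q : rat, F [set x | pabs (x - ratr q) <= (p%:R ^+ n)^-1].
  apply: contrapT => /forallNP nF.
  have FC N : F [set x : Qp | forall a : nat, (a < N)%N ->
      ~ pabs (x - ratr (a%:R / p%:R ^+ k)) <= (p%:R ^+ n)^-1].
    elim: N => [|N IHN]; first by apply: filterE => x a; rewrite ltn0.
    have [/nF//|FC] := in_ultra_setVsetC [set x : Qp |
      pabs (x - ratr (N%:R / p%:R ^+ k)) <= (p%:R ^+ n)^-1] FU.
    apply: filterS2 IHN FC => x xN /= xC a.
    by rewrite ltnS leq_eqVlt => /orP[/eqP->//|/xN].
  have [x [xk xa]] := filter_ex (filterI Fk (FC (p ^ (n + k))%N)).
  have [a ank] := Qp_approx_frac n xk.
  exact: xa.
have [q Fq] := choice Fn.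
have [x xq] : exists x, forall n, pabs (x - ratr (q n)) <= (p%:R ^+ n)^-1.
  apply: Qp_cauchy_lim; first exact: invr_pX_small.
  move=> m n mn; rewrite -(pabs_ratr p_prime) ratr_QpB.
  have [z [zn zm]] := filter_ex (filterI (Fq n) (Fq m)).
  rewrite -(subrKA z) addrC; apply: pabsD_le; first exact: zm.
  rewrite -opprB pabsN; apply: le_trans zn _.
  rewrite lef_pV2 ?posrE ?exprn_gt0 ?ltr0n ?prime_gt0//.
  by rewrite ler_eXn2l// ltr1n prime_gt1.
have Fx : F --> x.
  move=> A /nbhs_ballP[e /= e0 eA]; have [N Ne] := invr_pX_small e0.
  apply: filterS (Fq N) => z zN; apply: eA; rewrite Qp_ballE.
  apply: le_lt_trans (Ne _ (leqnn N)); rewrite -(subrKA (ratr (q N))).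
  by apply: pabsD_le; [exact: xq|rewrite -opprB pabsN; exact: zN].
exists x; split => //=.
have pk1 : (p%:R ^+ 0)^-1 <= p%:R ^+ k :> rat.
  by rewrite expr0 invr1 exprn_ege1// ler1n prime_gt0.
have [z [zk z0]] := filter_ex (filterI Fk (Fq 0%N)).
rewrite -(subrK z x); apply: pabsD_le; last exact: zk.
rewrite -(subrKA (ratr (q 0%N))); apply: pabsD_le.
  exact: le_trans (xq _) pk1.
by rewrite -opprB pabsN; exact: le_trans z0 pk1.
Qed.

Lemma Qp_compact_ball x e : 0 < e -> compact (ball x e).
Proof.
move=> e0; have [k xk] := Qp_pabs_bound x.
have [m em] : exists m : nat, e <= p%:R ^+ m.
  have := archi_boundP (ltW e0); set n := Num.Def.archi_bound _ => en.
  exists n; rewrite (le_trans (ltW en))// -natrX ler_nat ltnW// ltn_expl//.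
  exact: prime_gt1.
apply: subclosed_compact (@Qp_compact_ball0 (k + m)) _.
  exact: Qp_closed_ball.
have p1 n : 1 <= p%:R ^+ n :> rat by rewrite exprn_ege1// ler1n prime_gt0.
move=> y; rewrite Qp_ballE => xy /=; rewrite -(subKr x y); apply: pabsB_le.
  by apply: le_trans xk _; rewrite exprD ler_peMr// (le_trans ler01).
apply: le_trans (ltW xy) _; apply: le_trans em _.
by rewrite exprD ler_peMl// (le_trans ler01).
Qed.

Lemma Qp_continuousD x : continuous (fun z : Qp => z + x).
Proof.
move=> z A /nbhs_ballP[e /= e0 eA]; apply/nbhs_ballP; exists e => // y zy.
apply: eA; rewrite Qp_ballE opprD addrACA subrr addr0; exact: zy.
Qed.

Lemma Qp_continuousM x : continuous (fun z : Qp => z * x).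
Proof.
move=> z A /nbhs_ballP[e /= e0 eA]; apply/nbhs_ballP.
case: (eqVneq x 0) eA => [->|x0] eA.
  exists 1 => //= y _; apply: eA; rewrite Qp_ballE !mulr0 subrr pabs0; exact: e0.
have px0 := (pabs_nonnull x0).1.
exists (e / pabs x) => /=; first by rewrite divr_gt0.
move=> y; rewrite Qp_ballE ltr_pdivlMr// => zy; apply: eA.
by rewrite Qp_ballE -mulrBl pabsM; exact: zy.
Qed.

(** e_p is trivial on Z_p, so the value does not change as long as z * a stays within distance 1 of
    x * a. *)
Lemma Qp_near_expp (R : realType) a x : \forall z \near x, expp R (z * a) = expp R (x * a).
Proof.
have : nbhs x [set z | ball (x * a) 1 (z * a)].
  exact: (@Qp_continuousM a x (ball (x * a) 1) (nbhsx_ballx _ _ ltr01)).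
apply: filterS => z /= xz; rewrite Qp_ballE in xz.
rewrite -[in LHS](subrK (x * a) (z * a)) exppD -opprB expp_le1 ?mul1r//.
by rewrite pabsN; exact: ltW.
Qed.

Lemma Qp_dense_rat x e : 0 < e -> exists q : rat, ball x e (ratr q).
Proof. by move=> e0; have [q xq] := Qp_approx x e0; exists q; exact: xq. Qed.

End Qp_topology.

(** * Smooth functions on R and the flat function exp(-1/x) *)

Section smooth_functions.
Variable R : realType.
Implicit Types (f g : R -> R) (x c d : R) (n k : nat).

(** Carrying the derivatives as explicit witnesses makes closure under sums, products and affine
    changes of variable plain inductions; [derivable_derive1n_Cdiff] returns to iterated
    derivatives. *)
Fixpoint Cdiff n f : Prop := if n is n'.+1 then
  exists2 f' : R -> R, (forall x, is_derive x 1 f (f' x)) & Cdiff n' f'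
  else True.

Definition smooth f := forall n, Cdiff n f.

Lemma CdiffS n f : Cdiff n.+1 f -> Cdiff n f.
Proof.
elim: n f => [//|n IHn] f [f' ff' f'n]; exists f' => //.
exact: IHn.
Qed.

Lemma Cdiff_cst n c : Cdiff n (cst c).
Proof.
elim: n c => [//|n IHn] c; exists (cst 0) => // x.
exact: is_derive_cst.
Qed.

Lemma CdiffD n f g : Cdiff n f -> Cdiff n g -> Cdiff n (fun x => f x + g x).
Proof.
elim: n f g => [//|n IHn] f g [f' ff' nf'] [g' gg' ng'].
exists (fun x => f' x + g' x); last exact: IHn.
by move=> x; apply: is_deriveD.
Qed.

Lemma CdiffM n f g : Cdiff n f -> Cdiff n g -> Cdiff n (fun x => f x * g x).
Proof.
elim: n f g => [//|n IHn] f g nf ng; have [f' ff' nf'] := nf; have [g' gg' ng'] := ng.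
exists (fun x => f x * g' x + g x * f' x).
  by move=> x; apply: is_deriveM.
by apply: CdiffD; apply: IHn => //; exact: CdiffS.
Qed.

Lemma CdiffZ n c f : Cdiff n f -> Cdiff n (fun x => c * f x).
Proof. by move=> nf; apply: (CdiffM _ nf); exact: Cdiff_cst. Qed.

Lemma Cdiff_affine n c d f : Cdiff n f -> Cdiff n (fun x => f (c * x + d)).
Proof.
elim: n f => [//|n IHn] f [f' ff' nf'].
exists (fun x => c * f' (c * x + d)); last exact/CdiffZ/IHn.
move=> x; rewrite mulrC.
apply: (@is_derive1_comp _ f (fun x => c * x + d)).
have -> : (fun x => c * x + d) = c *: id + cst d by apply/funext.
by apply: is_derive_eq; rewrite addr0 [LHS]mulr1.
Qed.

Lemma Cdiff_trig n : Cdiff n sin /\ Cdiff n cos.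
Proof.
elim: n => [//|n [IHs IHc]]; split.
  by exists cos => // x; exact: is_derive_sin.
exists (fun x => -1 * sin x); last exact: CdiffZ.
by move=> x; rewrite mulN1r; exact: is_derive_cos.
Qed.

Lemma derivable_derive1n_Cdiff n f : Cdiff n.+1 f ->
  forall x, derivable (derive1n n f) x 1.
Proof.
elim: n f => [|n IHn] f [f' ff' nf'] x; first by case: (ff' x).
rewrite derive1Sn (_ : derive1 f = f'); first exact: IHn.
by apply/funext => z; rewrite derive1E; case: (ff' z).
Qed.

(** The difference quotient at 0 is bounded by c |h|. This settles the origin, where the formula for
    [flat] changes. *)
Lemma is_derive0_quadratic f c : (forall x, `|f x| <= c * x ^+ 2) ->
  is_derive (0 : R) 1 f 0.
Proof.
move=> fc; have f0 : f 0 = 0.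
  by apply/eqP; rewrite -normr_le0 (le_trans (fc 0))// expr0n mulr0.
have c0 : 0 <= c by have := le_trans (normr_ge0 _) (fc 1); rewrite expr1n mulr1.
have cvg0 : h^-1 *: (f (h *: 1 + 0) - f 0) @[h --> 0^'] --> (0 : R).
  apply/cvgrPdist_lt => e e0; near=> h.
  rewrite sub0r normrN f0 subr0 addr0 normrM normfV [h *: 1]mulr1.
  have h0 : 0 < `|h| by rewrite normr_gt0; near: h; exact: nbhs_dnbhs_neq.
  rewrite mulrC ltr_pdivrMr// (le_lt_trans (fc h))//.
  rewrite -real_normK ?num_real// expr2 mulrA ltr_pM2r//.
  (* Since c may be 0, c + 1 is used in order to divide by a positive number. *)
  apply: (@le_lt_trans _ _ ((c + 1) * `|h|)); first by rewrite ler_wpM2r// lerDl.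
  rewrite mulrC -ltr_pdivlMr ?ltr_wpDl//.
  near: h; apply: dnbhs0_lt; rewrite divr_gt0// ltr_wpDl//.
by apply: DeriveDef; [apply/cvg_ex; exists 0; exact: cvg0|exact: cvg_lim].
Unshelve. all: by end_near. Qed.

(* The k-fold derivatives of exp(-1/x) are linear combinations of these.      *)
Definition flat k x : R := if 0 < x then x^-1 ^+ k * expR (- x^-1) else 0.

(** With u = 1/x, a single term of the exponential series suffices: e^u >= u^(k+2) / (k+2)!. *)
Lemma flat_quadratic k x : `|flat k x| <= k.+2`!%:R * x ^+ 2.
Proof.
rewrite /flat; case: ltP => [x0|_]; last by rewrite normr0 mulr_ge0 ?sqr_ge0.
have u0 : 0 < x^-1 by rewrite invr_gt0.
rewrite ger0_norm ?mulr_ge0 ?exprn_ge0 ?expR_ge0 ?(ltW u0)//.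
have := expR_ge1Dxn k.+1 (ltW u0); set u := x^-1 => ue.
have xE : x ^+ 2 = (u ^+ 2)^-1 by rewrite /u exprVn invrK.
rewrite xE expRN ler_pdivrMr ?expR_gt0//.
rewrite mulrAC ler_pdivlMr ?exprn_gt0// -exprD addn2.
have fk : 0 < k.+2`!%:R :> R by rewrite ltr0n fact_gt0.
rewrite -ler_pdivrMl// mulrC (le_trans _ ue)// lerDr ler01//.
Qed.

(** The family [flat] is closed under differentiation up to linear combinations: it vanishes locally
    on the left, the product rule applies on the right, and the quadratic bound handles 0. *)
Lemma is_derive_flat k x :
  is_derive x 1 (flat k) (flat k.+2 x + (- k%:R) * flat k.+1 x).
Proof.
have [x0|x0|->] := ltgtP x 0.
- rewrite /flat !ltNge !(ltW x0)/= mulr0 addr0.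
  have D0 : is_derive x 1 (cst 0 : R -> R) 0 by exact: is_derive_cst.
  apply: near_eq_is_derive D0.
  near=> z; rewrite /flat ltNge (_ : z <= 0)//.
  by apply: ltW; near: z; exact: lt_nbhsl.
- have dV : is_derive x 1 (fun z : R => z^-1) (- x ^- 2 *: 1).
    by apply: is_deriveV; rewrite ?gt_eqF//; exact: is_derive_id.
  have dE : is_derive x 1 (fun z : R => expR (- z^-1))
      (expR (- x^-1) * (- (- x ^- 2 *: 1))).
    exact: (@is_derive1_comp _ expR (fun z => - z^-1) _ _ _ _ (is_deriveN dV)).
  have dX := is_deriveX k dV.
  have dM := is_deriveM dX dE.
  have nf : \near x, (((fun z : R => z^-1) ^+ k) * (fun z : R => expR (- z^-1))) x = flat k x.
    near=> z; rewrite /flat (_ : 0 < z) ?fctE//.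
    by near: z; exact: lt_nbhsr.
  suff <- : (((fun z : R => z^-1) ^+ k) x *: (expR (- x^-1) * - (- x ^- 2 *: 1)) +
      expR (- x^-1) *: ((k%:R * x^-1 ^+ k.-1) *: (- x ^- 2 *: 1)))
      = flat k.+2 x + - k%:R * flat k.+1 x by exact: near_eq_is_derive nf dM.
  rewrite /flat x0 fctE /GRing.scale/= -!exprVn !mulr1.
  (* The exponent [k.-1] from the power rule requires treating k = 0 apart. *)
  move: (x^-1) (expR _) => u E; case: k {dX dM nf} => [|k].
    by rewrite !mul0r mulr0 oppr0 mul0r; ring.
  by rewrite -[_.+1.-1]/k; move: (k.+1%:R : R) => N; rewrite !exprS expr0; ring.
- rewrite /flat ltxx mulr0 addr0.
  apply: (@is_derive0_quadratic _ k.+2`!%:R) => z; exact: flat_quadratic.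
Unshelve. all: by end_near. Qed.

Lemma Cdiff_flat n k : Cdiff n (flat k).
Proof.
elim: n k => [//|n IHn] k; exists (fun x => flat k.+2 x + (- k%:R) * flat k.+1 x).
  by move=> x; exact: is_derive_flat.
by apply: CdiffD => //; exact: CdiffZ.
Qed.

Lemma derive1n_eq0 f n (A : R) : (forall x, A < `|x| -> f x = 0) ->
  forall x, A < `|x| -> derive1n n f x = 0.
Proof.
move=> f0; elim: n => [//|n IHn] x Ax.
rewrite derive1nS derive1E (@near_eq_derive _ _ _ _ (cst 0)) ?derive_cst//.
near=> z; apply: IHn; near: z.
exact: (cvgr_gt _ (@norm_continuous _ _ x)).
Unshelve. all: by end_near. Qed.

(** Each x^m f^(n)(x) is continuous, hence bounded on a segment, and vanishes outside it. *)
Lemma schwartz_real_compact_support f (A : R) : smooth f ->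
  (forall x, A < `|x| -> f x = 0) -> schwartz_real f.
Proof.
move=> sf f0 n; have df := derivable_derive1n_Cdiff (sf n.+1).
split => // m.
pose g x := x ^+ m * derive1n n f x.
have gc : continuous g.
  move=> x; apply: (continuousM (@exprn_continuous _ m x)).
  exact/differentiable_continuous/derivable1_diffP.
(* A may be negative; the maximum with 0 keeps [-B, B] nonempty. *)
pose B := Num.max A 0.
have B0 : - B <= B by rewrite ge0_cp// le_max lexx orbT.
have gnc : {within `[(- B), B], continuous (fun x => `|g x|)}.
  apply: continuous_subspaceT => x; apply: continuous_comp; first exact: gc.
  exact: norm_continuous.
have [c _ cmax] := EVT_max B0 gnc.
exists `|g c| => x; have [xB|Bx] := leP `|x| B.
  by apply: cmax; rewrite in_itv/= -ler_norml.
rewrite (derive1n_eq0 n f0) ?mulr0 ?normr0//.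
by apply: le_lt_trans Bx; rewrite le_max lexx.
Qed.

End smooth_functions.

(** * Smooth bumps converging to the indicator of an open interval *)

Section bump.
Variable R : realType.
Implicit Types (a b x : R) (n : nat).

Lemma flat0E x : flat 0 x = if 0 < x then expR (- x^-1) else 0.
Proof. by rewrite /flat; case: ifP => // _; rewrite expr0 mul1r. Qed.

Lemma flat0_ge0 x : 0 <= flat 0 x.
Proof. by rewrite flat0E; case: ifP => // _; exact: expR_ge0. Qed.

Lemma flat0_le1 x : flat 0 x <= 1.
Proof.
rewrite flat0E; case: ifPn => // x0.
by rewrite -expR0 ler_expR oppr_le0 invr_ge0 ltW.
Qed.

Lemma flat0_gt0 x : (0 < flat 0 x) = (0 < x).
Proof. by rewrite flat0E; case: ifPn => [x0|_]; rewrite ?expR_gt0 ?ltxx. Qed.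

Lemma cvg_flat0 x : 0 < x -> flat 0 (n.+1%:R * x) @[n --> \oo] --> (1 : R).
Proof.
move=> x0.
have -> : (fun n => flat 0 (n.+1%:R * x)) = (fun n => expR (- (x^-1 * n.+1%:R^-1))).
  by apply/funext => n; rewrite flat0E mulr_gt0// invfM mulrC.
rewrite -[X in _ --> X]expR0 -[in X in _ --> X]oppr0 -(mulr0 x^-1).
apply: continuous_cvg; first exact: continuous_expR.
apply: cvgN; apply: cvgMr; exact: cvg_harmonic.
Qed.

(** Each factor vanishes up to one endpoint and tends to 1 beyond it, and the factor n + 1 steepens
    the transition. All values lie in [0, 1], which provides the domination used later. *)
Definition bump a b n x := flat 0 (n.+1%:R * (x - a)) * flat 0 (n.+1%:R * (b - x)).

Lemma bump_ge0 a b n x : 0 <= bump a b n x.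
Proof. by rewrite mulr_ge0 ?flat0_ge0. Qed.

Lemma bump_le1 a b n x : bump a b n x <= 1.
Proof. by rewrite mulr_ile1 ?flat0_ge0 ?flat0_le1. Qed.

Lemma bump_gt0 a b n x : (0 < bump a b n x) = (a < x < b).
Proof.
have fE : forall z, (flat 0 (n.+1%:R * z) == 0 :> R) = (z <= 0).
  move=> z; rewrite -[LHS]negbK -[RHS]negbK -ltNge; congr negb.
  by rewrite -(@pmulr_rgt0 _ n.+1%:R)// -flat0_gt0 lt_def flat0_ge0 andbT.
by rewrite lt_def bump_ge0 andbT mulf_eq0 !fE negb_or -!ltNge !subr_gt0.
Qed.

Lemma bump_eq0 a b n x : ~~ (a < x < b) -> bump a b n x = 0.
Proof. by rewrite -(bump_gt0 a b n) lt_def bump_ge0 andbT negbK => /eqP. Qed.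

Lemma smooth_bump a b n : smooth (bump a b n).
Proof.
move=> k; rewrite /bump.
have -> : (fun x => flat 0 (n.+1%:R * (x - a)) * flat 0 (n.+1%:R * (b - x))) =
   (fun x => flat 0 (n.+1%:R * x + - (n.+1%:R * a)) *
             flat 0 (- n.+1%:R * x + n.+1%:R * b)).
  by apply/funext => x; congr (flat 0 _ * flat 0 _); ring.
by apply: CdiffM; apply: (Cdiff_affine _ _ (@Cdiff_flat _ k 0)).
Qed.

Lemma cvg_bump a b x : (fun n => bump a b n x) n @[n --> \oo] --> ((a < x < b)%R%:R : R).
Proof.
case: (boolP (a < x < b)) => [/andP[ax xb]|axb].
  by rewrite -(mulr1 1%:R); apply: cvgM; apply: cvg_flat0; rewrite subr_gt0.
rewrite (_ : (fun n => _) = cst 0); first exact: cvg_cst.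
by apply/funext => n; rewrite bump_eq0.
Qed.

End bump.

(** * Squared norms and isometries of L^2 *)

Section L2_theory.
Context (d : measure_display) (T : measurableType d) (R : realType).
Variable mu : {measure set T -> \bar R}.
Implicit Types (f g : T -> R[i]) (u v : sqint mu) (F G : L2 mu).
Local Open Scope ereal_scope.

Lemma toL2E f (fP : f \in sqint_pred mu) : toL2 mu f = L2_class (Sqint fP).
Proof.
rewrite /toL2; congr L2_class; apply/val_inj; rewrite insubdK//.
Qed.

Lemma toL2_val u : toL2 mu u = L2_class u.
Proof. by rewrite (toL2E (valP u)); congr L2_class; exact/val_inj. Qed.

Lemma toL2_repr F : toL2 mu (L2_repr F) = F.
Proof. by rewrite toL2_val L2_reprK. Qed.

Lemma L2_class0 : L2_class (0%R : sqint mu) = 0%R.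
Proof. exact: raddf0. Qed.

Lemma toL2_junk f : f \notin sqint_pred mu -> toL2 mu f = 0%R.
Proof. by move=> fP; rewrite /toL2 /insubd insubN//= L2_class0. Qed.

Lemma L2_class_eq0 u : (L2_class u == 0%R) = (u \in @aenull _ _ _ mu).
Proof. by rewrite -L2_class0 L2_class_eq subr0. Qed.

Lemma sqintZD a f g : f \in sqint_pred mu -> g \in sqint_pred mu ->
  (fun t => a * f t + g t)%R \in sqint_pred mu.
Proof. by move=> fP gP; exact: (sqint_submod_closed mu).2. Qed.

Lemma toL2ZD a f g : f \in sqint_pred mu -> g \in sqint_pred mu ->
  toL2 mu (fun t => a * f t + g t)%R = (a *: toL2 mu f + toL2 mu g)%R.
Proof.
move=> fP gP; rewrite (toL2E (sqintZD a fP gP)) (toL2E fP) (toL2E gP).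
rewrite -[(a *: L2_class _)%R]/(L2_scale a _) -L2_classZ -L2_classD.
by congr L2_class; apply/val_inj.
Qed.

Lemma ae_toL2 f g : f \in sqint_pred mu -> g \in sqint_pred mu ->
  toL2 mu f = toL2 mu g -> {ae mu, forall t, f t = g t}.
Proof.
move=> fP gP; rewrite (toL2E fP) (toL2E gP) => /eqP.
rewrite L2_class_eq => /aenullP; apply: filterS => t /eqP.
by rewrite subr_eq0 => /eqP.
Qed.

Definition sqnorm f := \int[mu]_t (sqnormc (f t))%:E.

Definition L2_sqnorm F := sqnorm (L2_repr F).

Lemma sqint_measurable f : f \in sqint_pred mu -> cmeasurable f.
Proof. by move=> /sqint_predP[]. Qed.

Lemma sqnormc_EFin_ge0 (z : R[i]) : 0 <= (sqnormc z)%:E.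
Proof. by rewrite lee_fin sqnormc_ge0. Qed.
#[local] Hint Resolve sqnormc_EFin_ge0 : core.

Lemma sqnorm_ge0 f : 0 <= sqnorm f.
Proof. exact: integral_ge0. Qed.

Lemma sqnormc_eq0 (z : R[i]) : sqnormc z = 0%R -> z = 0%R.
Proof.
case: z => a b; rewrite /sqnormc/= => /eqP.
by rewrite paddr_eq0 ?sqr_ge0// !sqrf_eq0 => /andP[/eqP-> /eqP->].
Qed.

Lemma L2_sqnorm_toL2 f : f \in sqint_pred mu -> L2_sqnorm (toL2 mu f) = sqnorm f.
Proof.
move=> fP; apply: ae_eq_integral => //.
- exact: measurable_sqnormc (sqint_measurable (valP _)).
- exact: measurable_sqnormc (sqint_measurable fP).
have := ae_toL2 (valP (L2_repr (toL2 mu f))) fP (toL2_repr _).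
by apply: filterS => t /= ->.
Qed.

Lemma L2_sqnorm_lty F : L2_sqnorm F < +oo.
Proof. by have /sqint_predP[] := valP (L2_repr F). Qed.

Lemma L2_sqnorm_ge0 F : 0 <= L2_sqnorm F.
Proof. exact: sqnorm_ge0. Qed.

Lemma L2_sqnorm_eq0 F : L2_sqnorm F = 0 -> F = 0%R.
Proof.
move=> F0; rewrite -(L2_reprK F); apply/eqP; rewrite L2_class_eq0.
apply/aenullP; have FP := sqint_measurable (valP (L2_repr F)).
have := (ae_eq_integral_abs mu measurableT (measurable_sqnormc FP)).1.
rewrite (_ : \int[mu]_t _ = 0); last first.
  by rewrite -[RHS]F0; apply: eq_integral => t _; rewrite gee0_abs.
by move=> /(_ erefl); apply: filterS => t /(_ I) [] /sqnormc_eq0.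
Qed.

(** This weak form of the triangle inequality, integrated from [sqnormcD], is all that the
    closedness arguments require. *)
Lemma L2_sqnormD F G : L2_sqnorm (F + G)%R <= 2%:E * (L2_sqnorm F + L2_sqnorm G).
Proof.
set f := L2_repr F; set g := L2_repr G.
have fP : (f : T -> R[i]) \in sqint_pred mu := valP f.
have gP : (g : T -> R[i]) \in sqint_pred mu := valP g.
have -> : (F + G = toL2 mu (fun t => 1 * f t + g t))%R.
  by rewrite toL2ZD// scale1r !toL2_repr.
rewrite L2_sqnorm_toL2 ?sqintZD//.
have mf := measurable_sqnormc (sqint_measurable fP).
have mg := measurable_sqnormc (sqint_measurable gP).
rewrite -[L2_sqnorm F]/(sqnorm f) -[L2_sqnorm G]/(sqnorm g) /sqnorm.
rewrite -ge0_integralD// -ge0_integralZl//; last 2 first.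
- exact: emeasurable_funD.
- by move=> t _; rewrite adde_ge0.
apply: ge0_le_integral => //.
- exact: measurable_sqnormc (sqint_measurable (sqintZD 1 fP gP)).
- by apply: measurable_funeM; apply: emeasurable_funD.
- by move=> t _; rewrite mul1r -EFinD -EFinM lee_fin sqnormcD.
Qed.

Lemma L2_sqnormN F : L2_sqnorm (- F)%R = L2_sqnorm F.
Proof.
set f := L2_repr F.
have fP : (f : T -> R[i]) \in sqint_pred mu := valP f.
have -> : (- F = toL2 mu (fun t => -1 * f t + 0))%R.
  rewrite (@toL2ZD _ _ (fun=> 0%R)) ?toL2_repr ?scaleN1r//.
    by rewrite (_ : toL2 mu (fun=> 0%R) = 0%R) ?addr0// -L2_class0 -toL2_val.
  exact: (sqint_submod_closed mu).1.
rewrite L2_sqnorm_toL2; last first.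
  by apply: sqintZD => //; exact: (sqint_submod_closed mu).1.
apply: eq_integral => t _; rewrite addr0 mulN1r; congr EFin.
by case: (f t) => a b; rewrite /sqnormc/= !sqrrN.
Qed.

Lemma unitary_sqnorm (U : L2 mu -> L2 mu) : unitary_op U ->
  forall F, L2_sqnorm (U F) = L2_sqnorm F.
Proof.
case=> _ _ dotU F.
have dotE G : complex.Re (L2_dot G G) = fine (L2_sqnorm G).
  rewrite /L2_dot /cintegral/= /Rintegral; congr fine; apply: eq_integral => t _.
  congr EFin; case: (L2_repr G t) => a b; rewrite /sqnormc/=; ring.
have fin G : L2_sqnorm G \is a fin_num.
  by rewrite ge0_fin_numE ?L2_sqnorm_lty ?L2_sqnorm_ge0.
by rewrite -(fineK (fin F)) -(fineK (fin (U F))) -!dotE dotU.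
Qed.

(** If A G = B G, then A F - B F = A (F - G) - B (F - G), and both terms are as small as F - G. *)
Lemma isometry_equalizer_closed (A B : L2 mu -> L2 mu) F :
  (forall F G, A (F - G) = A F - A G)%R -> (forall F G, B (F - G) = B F - B G)%R ->
  (forall F, L2_sqnorm (A F) = L2_sqnorm F) ->
  (forall F, L2_sqnorm (B F) = L2_sqnorm F) ->
  (forall e : R, (0 < e)%R -> exists2 G, A G = B G & L2_sqnorm (F - G)%R <= e%:E) ->
  A F = B F.
Proof.
move=> AB BB AN BN approx; apply/eqP; rewrite -subr_eq0; apply/eqP.
apply: L2_sqnorm_eq0; apply/eqP; rewrite eq_le L2_sqnorm_ge0 andbT.
apply/lee_addgt0Pr => e e0; rewrite add0e.
(* Two errors e / 4 give 2 (e / 4 + e / 4) = e in [L2_sqnormD]. *)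
have [G AG FG] := approx (e / 4)%R ltac:(by rewrite divr_gt0).
have -> : (A F - B F = A (F - G) + - B (F - G))%R.
  by rewrite AB BB AG opprB addrA subrK.
apply: le_trans (L2_sqnormD _ _) _; rewrite L2_sqnormN AN BN.
apply: (@le_trans _ _ (2%:E * ((e / 4)%:E + (e / 4)%:E))).
  by rewrite lee_pmul2l// leeD.
by rewrite -EFinD -EFinM lee_fin; lra.
Qed.

End L2_theory.

(** * Borel sets of M and a pi-system generating them *)

Section QpR_borel.
Variables (R : realType) (p : nat) (p_prime : prime p).
Local Notation Qp := (Qp p_prime).
Local Notation M := (QpR R p_prime).

Lemma open_measurable_QpR (U : set M) : open U -> measurable U.
Proof. by move=> oU; exact: sub_sigma_algebra. Qed.

Lemma nbhs_open_QpR (A : set M) : (forall t, A t -> nbhs t A) -> open A.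
Proof. by move=> nA; rewrite openE. Qed.

Lemma measurable_fun_open (f : M -> R) :
  (forall V : set R, open V -> open (f @^-1` V)) -> measurable_fun setT f.
Proof.
move=> fo mT; apply: (measurability _ (RGenOInfty.measurableE R)) => //.
move=> _ [_ [a ->] <-]; rewrite setTI; apply: open_measurable_QpR.
by apply: fo; rewrite set_itvE; exact: open_gt.
Qed.

Lemma nbhs_QpRP (t : M) (A : set M) : nbhs t A <->
  exists2 e : rat, 0 < e & exists2 r : R, 0 < r &
    forall s : M, ball t.1 e s.1 -> `|t.2 - s.2| < r -> A s.
Proof.
split.
  move=> [[P Q]] /= [/nbhs_ballP[e e0 eP] /nbhs_ballP[r r0 rQ]] PQA.
  exists e => //; exists r => // s se sr; apply: PQA; split => /=.
    exact: eP.
  exact: rQ.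
move=> [e e0 [r r0 erA]]; exists (ball t.1 e, ball t.2 r) => /=.
  by split; apply/nbhs_ballP; [exists e|exists r].
by move=> s [/= se sr]; exact: erA.
Qed.

Lemma measurable_fun_fst (f : Qp -> R) :
  (forall x, \forall z \near x, f z = f x) -> measurable_fun setT (fun t : M => f t.1).
Proof.
move=> fl; apply: measurable_fun_open => V _; rewrite openE => t /= tV.
have /nbhs_ballP[e /= e0 eV] := fl t.1.
apply/nbhs_QpRP; exists e => //; exists 1 => // s ts _ /=.
by rewrite (eV _ ts).
Qed.

Lemma measurable_fun_snd (f : R -> R) :
  measurable_fun setT f -> measurable_fun setT (fun t : M => f t.2).
Proof.
move=> mf; apply: (measurableT_comp mf).
apply: measurable_fun_open => V oV; rewrite openE => t /= tV.
have /nbhs_ballP[r /= r0 rV] : nbhs t.2 V by apply: open_nbhs_nbhs.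
apply/nbhs_QpRP; exists 1 => //; exists r => // s _ sr /=; exact: rV.
Qed.

Lemma measurable_addrM (x : M) : measurable_fun setT (fun t : M => t + x : M).
Proof.
move=> mT; apply: (measurability (@open M)) => //.
move=> _ [U oU <-]; rewrite setTI; apply: open_measurable_QpR.
apply: nbhs_open_QpR => t /= tU.
have /nbhs_QpRP[e e0 [r r0 erU]] : nbhs (t + x) U by apply: open_nbhs_nbhs.
apply/nbhs_QpRP; exists e => //; exists r => // s se sr /=; apply: erU => /=.
  by rewrite Qp_ballE opprD addrACA subrr addr0; exact: se.
by rewrite opprD addrACA subrr addr0.
Qed.


Definition rect (S : set Qp) (a b : R) : set M := [set t | S t.1 /\ a < t.2 < b].

(** A clopen base has a locally constant indicator, as Bruhat-Schwartz functions require, and its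
    boundedness makes the Haar measure of the rectangle finite. *)
Definition clopen_rects : set (set M) := [set A | exists (S : set Qp) a b,
  [/\ open S, closed S, (exists2 e : rat, 0 < e & S `<=` ball (0 : Qp) e) & A = rect S a b]].

Lemma clopen_rects_setI : setI_closed clopen_rects.
Proof.
move=> _ _ [S [a [b [So Sc [e e0 Se] ->]]]] [S' [a' [b' [So' Sc' _ ->]]]].
exists (S `&` S'), (Num.max a a'), (Num.min b b'); split.
- exact: openI.
- exact: closedI.
- by exists e => // x [/Se].
apply/seteqP; split => t.
  by move=> [[St /andP[at1 tb]] [St' /andP[at2 tb']]]; split => //; rewrite gt_max lt_min at1 at2 tb.
move=> [[St St']]; rewrite gt_max lt_min => /andP[/andP[? ?] /andP[? ?]].
by split; split => //; apply/andP.
Qed.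

Lemma open_rect S a b : open S -> open (rect S a b).
Proof.
move=> So; rewrite openE => t [St /andP[ta tb]].
have /nbhs_ballP[e /= e0 eS] : nbhs t.1 S by apply: open_nbhs_nbhs.
apply/nbhs_QpRP; exists e => //.
exists (Num.min (t.2 - a) (b - t.2)); first by rewrite lt_min !subr_gt0 ta.
move=> s ts; rewrite lt_min !ltr_norml => /andP[/andP[h1 h2] /andP[h3 h4]].
by split; [exact: eS|apply/andP; split; lra].
Qed.

Lemma ball0_rat_in (x : Qp) (e : rat) : 0 < e ->
  exists2 e' : rat, 0 < e' & ball x e `<=` ball (0 : Qp) e'.
Proof.
move=> e0; exists (e + pabs x); first by rewrite ltr_pwDl// pabs_ge0.
move=> z; rewrite !Qp_ballE => xz; rewrite sub0r pabsN -(subKr x z).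
apply: le_lt_trans (pabsB _ _) _; rewrite gt_max; apply/andP; split.
  by rewrite ltrDr.
by apply: (lt_le_trans xz); rewrite lerDl pabs_ge0.
Qed.

(** M has a countable base of such rectangles: rational centres, radii 1 / (n + 1), rational
    endpoints. *)
Lemma open_sigma_clopen_rects (U : set M) : open U -> <<s clopen_rects >> U.
Proof.
move=> oU.
pose V (i : rat * nat * rat * rat) : set M :=
  let: (q, n, a, b) := i in rect (ball (ratr q : Qp) n.+1%:R^-1) (ratr a) (ratr b).
pose D := [set i | V i `<=` U].
(* Indices whose rectangle is not inside U contribute the empty set, so the union runs over a whole
   countable type. *)
have -> : U = \bigcup_i (if i \in D then V i else set0).
  apply/seteqP; split => [t Ut|t [i _]]; last by case: ifPn => // /set_mem; exact.
  have /nbhs_QpRP[e e0 [r r0 erU]] : nbhs t U by apply: open_nbhs_nbhs.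
  have [n ne] : exists n : nat, n.+1%:R^-1 < e.
    exists (Num.Def.archi_bound e^-1).
    rewrite invf_plt ?posrE// (lt_trans (archi_boundP _)) ?ltr_nat//.
    by rewrite invr_ge0 ltW.
  have n0 : 0 < n.+1%:R^-1 :> rat by rewrite invr_gt0.
  have [q tq] := Qp_dense_rat t.1 n0.
  have [a] := @rat_in_itvoo R (t.2 - r) t.2 ltac:(by rewrite gtrBl).
  rewrite in_itv/= => /andP[ra at_].
  have [b] := @rat_in_itvoo R t.2 (t.2 + r) ltac:(by rewrite ltrDl).
  rewrite in_itv/= => /andP[tb br].
  exists (q, n, a, b) => //; rewrite ifT.
    by split => /=; [exact: ball_sym|rewrite at_ tb].
  apply/mem_set => s [/= sq /andP[as_ sb]]; apply: erU.
    (* By the ultrametric inequality, a ball about q containing t.1 lies in the ball of the same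
       radius about t.1. *)
    have : ball t.1 n.+1%:R^-1 s.1 by exact: Qp_ball_trans tq sq.
    by rewrite !Qp_ballE => /lt_trans; exact.
  by rewrite ltr_norml; apply/andP; split; lra.
apply: (@countable_bigcupT_measurable _ (g_sigma_algebraType clopen_rects)).
  exact: countableP.
move=> [[[q n] a] b]; case: ifPn => _; last exact: measurable0.
have n0 : 0 < n.+1%:R^-1 :> rat by rewrite invr_gt0.
apply: sub_sigma_algebra; exists (ball (ratr q : Qp) n.+1%:R^-1), (ratr a), (ratr b); split => //.
- exact: Qp_open_ball.
- exact: Qp_closed_ball.
- exact: ball0_rat_in.
Qed.

Lemma measurable_sigma_clopen_rects (A : set M) : measurable A -> <<s clopen_rects >> A.
Proof.
apply: smallest_sub; first exact: smallest_sigma_algebra.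
exact: open_sigma_clopen_rects.
Qed.

End QpR_borel.

Import HBNNSimple.

(** * A closed subspace of L^2 containing the indicators of a generating pi-system is everything *)

Section dominated_density.
Context (d : measure_display) (T : measurableType d) (R : realType).
Variable mu : {measure set T -> \bar R}.
Variable E : set (L2 mu).
Hypothesis E_linear : forall a F G, E F -> E G -> E (a *: F + G).
Hypothesis E_closed : forall F, (forall e : R, 0 < e ->
  exists2 G, E G & (L2_sqnorm (F - G)%R <= e%:E)%E) -> E F.
Implicit Types f g : T -> R.

Definition realc f : T -> R[i] := fun t => Complex (f t) 0.

(** Square-integrability is demanded because [toL2] sends any other function to 0, whose membership
    in [E] says nothing about f. *)
Definition mem_real f := realc f \in sqint_pred mu /\ E (toL2 mu (realc f)).

Lemma sqnormc_realc f t : sqnormc (realc f t) = f t ^+ 2.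
Proof. by rewrite /sqnormc/= expr0n addr0. Qed.

Lemma realc_sqint f g : measurable_fun setT f -> measurable_fun setT g ->
  (forall t, f t ^+ 2 <= g t) -> (\int[mu]_t (g t)%:E < +oo)%E ->
  realc f \in sqint_pred mu.
Proof.
move=> mf mg fg gi; apply/sqint_predP; split.
  by split => //=; exact: measurable_cst.
apply: le_lt_trans gi; apply: ge0_le_integral => //.
- by move=> t _; rewrite lee_fin sqnormc_ge0.
- by apply: measurable_sqnormc; split => //=; exact: measurable_cst.
- exact/measurable_EFinP.
- by move=> t _; rewrite sqnormc_realc lee_fin.
Qed.

Lemma mem_realZD c f g : mem_real f -> mem_real g -> mem_real (fun t => c * f t + g t).
Proof.
move=> [fP fE] [gP gE].
have -> : mem_real (fun t => c * f t + g t) =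
  (realc (fun t => c * f t + g t) \in sqint_pred mu /\
   E (toL2 mu (realc (fun t => c * f t + g t)))) by [].
have -> : realc (fun t => c * f t + g t) =
    (fun t => Complex c 0 * realc f t + realc g t).
  apply/funext => t; apply/eqP; rewrite eq_complex/=; apply/andP.
  by split; apply/eqP; ring.
by split; [exact: sqintZD|rewrite toL2ZD//; exact: E_linear].
Qed.

(** Dominated convergence applied to (f - f_n)^2 gives convergence in L^2, and [E] is closed. *)
Lemma mem_real_dominated (f_ : nat -> T -> R) f g :
  (forall n, mem_real (f_ n)) -> measurable_fun setT f ->
  (forall t, f_ n t @[n --> \oo] --> f t) ->
  measurable_fun setT g -> (\int[mu]_t (g t)%:E < +oo)%E ->
  (forall n t, f_ n t ^+ 2 <= g t) -> (forall t, f t ^+ 2 <= g t) ->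
  mem_real f.
Proof.
move=> f_E mf f_f mg gi f_g fg.
have fP := realc_sqint mf mg fg gi.
have g0 t : 0 <= g t := le_trans (sqr_ge0 _) (fg t).
split => //; apply: E_closed => e e0.
have mf_ n : measurable_fun setT (f_ n).
  by have [/sqint_predP[[]]] := f_E n.
pose h n t := ((f t - f_ n t) ^+ 2)%:E.
have mh n : measurable_fun setT (h n).
  by apply/measurable_EFinP; apply: measurable_funX; exact: measurable_funB.
(* (f - f_n)^2 + (f + f_n)^2 = 2 f^2 + 2 f_n^2 <= 4 g. *)
have h4 n t : (`|h n t| <= (4 * g t)%:E)%E.
  rewrite gee0_abs ?lee_fin ?sqr_ge0//.
  have := f_g n t; have := fg t; have := sqr_ge0 (f t + f_ n t).
  rewrite !expr2; nra.
have h_0 t : h n t @[n --> \oo] --> 0%E.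
  apply: cvg_EFin; first by near=> n.
  rewrite -[X in _ --> X](mul0r 0) -(subrr (f t)).
  have sub0 : (f t - f_ n t) @[n --> \oo] --> f t - f t.
    by apply: cvgB; [exact: cvg_cst|exact: f_f].
  rewrite (_ : fine \o _ = fun n => (f t - f_ n t) * (f t - f_ n t)).
    exact: cvgM.
  by apply/funext => n; rewrite /= expr2.
have ig : mu.-integrable setT (fun t => (4 * g t)%:E).
  apply/integrableP; split; first by apply/measurable_EFinP; exact: measurable_funM.
  under eq_integral do rewrite gee0_abs ?lee_fin ?mulr_ge0// EFinM.
  rewrite ge0_integralZl//.
  - by rewrite lte_mul_pinfty.
  - exact/measurable_EFinP.
  - by move=> t _; rewrite lee_fin.
have [_ _] := dominated_convergence measurableT mh (measurable_cst (0%E : \bar R))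
   (aeW _ (fun t _ => h_0 t)) ig (aeW _ (fun t n _ => h4 n t)).
rewrite integral0 => /fine_cvgP[fin lim0].
have [n [finn /= hn]] := filter_ex (filterI fin (cvgr_lt _ lim0 _ e0)).
have [fnP Efn] := f_E n.
exists (toL2 mu (realc (f_ n))) => //.
rewrite -scaleN1r addrC -toL2ZD// L2_sqnorm_toL2 ?sqintZD//.
rewrite (_ : sqnorm _ _ = \int[mu]_t h n t)%E.
  have fh : (\int[mu]_t h n t)%E \is a fin_num := finn.
  by rewrite -(fineK fh) lee_fin ltW.
apply: eq_integral => t _; rewrite /h /sqnormc /realc/=; congr EFin; ring.
Unshelve. all: by end_near. Qed.

Lemma mem_real_sum (I : Type) (r : seq I) (F : I -> T -> R) :
  mem_real (fun=> 0) -> (forall i, mem_real (F i)) ->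
  mem_real (fun t => \sum_(i <- r) F i t).
Proof.
move=> m0 mF; elim: r => [|i r IHr].
  by rewrite (_ : (fun t => _) = fun=> 0)//; apply/funext => t; rewrite big_nil.
rewrite (_ : (fun t => _) = fun t => 1 * F i t + \sum_(i <- r) F i t).
  exact: mem_realZD.
by apply/funext => t; rewrite big_cons mul1r.
Qed.

(* Dynkin's lemma extends membership from the pi-system to indicators of all  *)
(* measurable sets, then simple functions and dominated limits exhaust L^2.   *)
Variables (G : set (set T)) (K : nat -> set T).
Hypothesis G_setI : setI_closed G.
Hypothesis G_mem : forall A, G A -> mem_real \1_A.
Hypothesis G_meas : @measurable _ T `<=` <<s G >>.
Hypothesis GK : forall n, G (K n).
Hypothesis G_measurable : G `<=` measurable.
Hypothesis K_fin : forall n, (mu (K n) < +oo)%E.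
Hypothesis K_exhaust : forall t, \forall n \near \oo, K n t.

(** Cutting by [K n] keeps measures finite. The sets whose trace on [K n] has its indicator in [E]
    form a lambda-system containing [G]. *)
Lemma mem_real_indic A n : measurable A -> mem_real \1_(A `&` K n).
Proof.
move=> mA.
have mK : measurable (K n) by apply: G_measurable.
pose H := [set B : set T | measurable B /\ mem_real \1_(B `&` K n)].
suff : H A by case.
apply: (lambda_system_subset G_setI (D := setT) (H := H)) => //; last exact: G_meas.
- split => //.
  + by split => //; rewrite setTI; exact: G_mem.
  + move=> B C CB [mB EB] [mC EC]; split; first exact: measurableD.
    rewrite (_ : \1_((B `\` C) `&` K n) =
       fun t => -1 * \1_(C `&` K n) t + \1_(B `&` K n) t); first exact: mem_realZD.
    apply/funext => t; rewrite !indicE (in_setI _ (B `\` C)) in_setD (in_setI _ C) (in_setI _ B).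
    have : (t \in C) ==> (t \in B) by apply/implyP => /set_mem/CB/mem_set.
    by case: (t \in B) (t \in C) (t \in K n) => [] [] [] //= _; ring.
  (* For an increasing union the indicators are eventually constant at each point and are dominated
     by that of [K n]. *)
  + move=> F ndF FH; split; first by apply: bigcup_measurable => i _; case: (FH i).
    apply: (@mem_real_dominated (fun i => \1_(F i `&` K n)) _ \1_(K n)) => //.
    * by move=> i; case: (FH i).
    * apply: measurable_indic; apply: measurableI => //.
      by apply: bigcup_measurable => i _; case: (FH i).
    * move=> t; apply: cvg_near_cst.
      rewrite indicE in_setI.
      have [/set_mem[i _ Fit]|nF] := boolP (t \in \bigcup_i F i).
        exists i => // j /= ij; rewrite indicE in_setI.
        by rewrite (_ : t \in F j)//; apply/mem_set; move: Fit; apply/subsetPset/ndF.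
      near=> j; rewrite indicE in_setI (_ : t \in F j = false)//.
      by apply/negbTE; apply: contra nF => /set_mem Fj; apply/mem_set; exists j.
    * by rewrite integral_indic// setIT.
    * move=> i t; rewrite !indicE in_setI.
      by case: (t \in F i); case: (t \in K n); rewrite /= ?expr1n ?expr0n.
    * move=> t; rewrite !indicE in_setI.
      by case: (t \in _); case: (t \in K n); rewrite /= ?expr1n ?expr0n.
- move=> B GB; split; first exact: G_measurable.
  by apply: G_mem; exact: G_setI.
Unshelve. all: by end_near. Qed.

Lemma mem_real0 : mem_real (fun=> 0).
Proof.
have := @mem_real_indic set0 0 measurable0; rewrite set0I.
by rewrite (_ : \1_set0 = fun=> 0)//; apply/funext => t; rewrite indicE in_set0.
Qed.

Lemma mem_real_ge0 f : measurable_fun setT f -> (forall t, 0 <= f t) ->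
  (\int[mu]_t (f t ^+ 2)%:E < +oo)%E -> mem_real f.
Proof.
move=> mf f0 fi.
have mEf : measurable_fun setT (EFin \o f) by exact/measurable_EFinP.
pose a n : T -> R := nnsfun_approx measurableT mEf n.
have Ef0 t : setT t -> (0 <= (EFin \o f) t)%E by rewrite /= lee_fin.
have af n t : a n t <= f t.
  by rewrite -lee_fin /a nnsfun_approxE (le_approx _ Ef0).
have a0 n t : 0 <= a n t by exact: fun_ge0.
apply: (@mem_real_dominated (fun n t => a n t * \1_(K n) t) _ (fun t => f t ^+ 2)) => //.
(* A simple function cut off to [K n] is a finite combination of indicators of its level sets
   intersected with [K n]. *)
- move=> n; rewrite /a; set s := nnsfun_approx _ _ n.
  rewrite (_ : (fun t => _) = fun t => \sum_(r <- finmap.enum_fset (fset_set (range s)))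
     (r * \1_(s @^-1` [set r] `&` K n) t + 0)).
    apply: mem_real_sum; first exact: mem_real0.
    move=> r; apply: (@mem_realZD r _ (fun=> 0)); last exact: mem_real0.
    exact/mem_real_indic/measurable_funPTI.
  apply/funext => t; rewrite [in LHS]fimfunE fsbig_finite; last exact: fimfunP.
  rewrite mulr_suml; apply: eq_bigr => r _.
  by rewrite addr0 -mulrA !indicE in_setI -natrM mulnb.
- move=> t; rewrite -[X in _ --> X]mulr1; apply: cvgM.
    have /fine_cvgP[] := @cvg_nnsfun_approx _ _ _ _ measurableT _ mEf Ef0 t I.
    exact.
  apply: cvg_near_cst; apply: filterS (K_exhaust t) => n Kn.
  by rewrite indicE mem_set.
- exact: measurable_funX.
- move=> n t; rewrite lerXn2r ?nnegrE ?mulr_ge0//.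
  by rewrite (le_trans _ (af n t))// ler_piMr// indicE; case: (_ \in _).
Qed.

Lemma mem_real_measurable f : measurable_fun setT f ->
  (\int[mu]_t (f t ^+ 2)%:E < +oo)%E -> mem_real f.
Proof.
move=> mf fi.
have mE : measurable_fun setT (fun t => (f t ^+ 2)%:E).
  by apply/measurable_EFinP; exact: measurable_funX.
(* This is applied to the positive and negative parts of f, whose squares are at most f^2. *)
have part (g : T -> R) : measurable_fun setT g -> (forall t, 0 <= g t) ->
    (forall t, g t ^+ 2 <= f t ^+ 2) -> mem_real g.
  move=> mg g0 gf; apply: mem_real_ge0 => //; apply: le_lt_trans fi.
  apply: ge0_le_integral => //.
  - by move=> t _; rewrite lee_fin sqr_ge0.
  - by apply/measurable_EFinP; exact: measurable_funX.
  - by move=> t _; rewrite lee_fin.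
rewrite (_ : f = fun t => -1 * Num.max (- f t) 0 + Num.max (f t) 0).
  apply: mem_realZD; apply: part => //.
  - by apply: measurable_maxr => //; exact: measurableT_comp.
  - by move=> t; rewrite le_max lexx orbT.
  - by move=> t; case: (leP (- f t) 0) => _; rewrite ?sqrrN ?expr0n ?sqr_ge0.
  - by apply: measurable_maxr.
  - by move=> t; rewrite le_max lexx orbT.
  - by move=> t; case: (leP (f t) 0) => _; rewrite ?expr0n ?sqr_ge0.
apply/funext => t; case: (leP (- f t) 0); case: (leP (f t) 0); lra.
Qed.

Lemma dominated_density F : E F.
Proof.
pose f := L2_repr F.
have [[mr mi] fi] := sqint_predP _ _ (valP f).
have dom (g : T -> R) : measurable_fun setT g ->
    (forall t, g t ^+ 2 <= sqnormc (f t)) -> mem_real g.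
  move=> mg gf; apply: mem_real_measurable => //; apply: le_lt_trans fi.
  apply: ge0_le_integral => //.
  - by move=> t _; rewrite lee_fin sqr_ge0.
  - by apply/measurable_EFinP; exact: measurable_funX.
  - by apply: measurable_sqnormc.
  - by move=> t _; rewrite lee_fin; exact: gf.
have [rP rE] : mem_real (fun t => complex.Re (f t)).
  by apply: dom => // t; rewrite lerDl sqr_ge0.
have [iP iE] : mem_real (fun t => complex.Im (f t)).
  by apply: dom => // t; rewrite lerDr sqr_ge0.
rewrite -(toL2_repr F).
rewrite (_ : (L2_repr F : T -> R[i]) = fun t =>
  Complex 0 1 * realc (fun t => complex.Im (f t)) t + realc (fun t => complex.Re (f t)) t).
  by rewrite toL2ZD//; exact: E_linear.
apply/funext => t; rewrite -/f /realc; case: (f t) => a b.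
by apply/eqP; rewrite eq_complex/=; apply/andP; split; apply/eqP; ring.
Qed.

End dominated_density.

(** * Haar invariance and the Weyl operators as linear isometries *)

Section weyl_theory.
Variables (R : realType) (p : nat) (p_prime : prime p).
Local Notation M := (QpR R p_prime).
Local Notation Qp := (Qp p_prime).
Variables (alpha0 : R) (y : Qp) (mu : {measure set M -> \bar R}).
Hypothesis mu_haar : haar_measure mu.
Local Notation chi := (chi alpha0 y).

Lemma haar_preimage_addr (A : set M) (x : M) : measurable A ->
  mu ((fun t => t + x) @^-1` A) = mu A.
Proof.
case: mu_haar => mu_add _ _ mA; rewrite -(mu_add _ (- x) mA); congr (mu _).
apply/seteqP; split => [t /= At|_ [a Aa <-]] /=.
  by exists (t + x) => //; rewrite addrCA addNr addr0.
by rewrite addrAC addNr add0r.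
Qed.

(** By invariance, the pushforward of [mu] under a translation is [mu] again. *)
Lemma ge0_integral_addr (f : M -> \bar R) (x : M) : measurable_fun setT f ->
  (forall t, 0 <= f t)%E -> (\int[mu]_t f (t + x)%R = \int[mu]_t f t)%E.
Proof.
move=> mf f0.
have := @ge0_integral_pushforward _ _ _ _ _ _ (measurable_addrM x) mu setT f
  measurableT mf (fun t _ => f0 t).
rewrite preimage_setT => <-; apply: eq_measure_integral => [|mphi A mA _]; first exact: measurable_addrM.
exact: haar_preimage_addr.
Qed.

Lemma integral_addr (f : M -> \bar R) (x : M) : measurable_fun setT f ->
  (\int[mu]_t f (t + x)%R = \int[mu]_t f t)%E.
Proof.
move=> mf; rewrite integralE [RHS]integralE; congr (_ - _)%E.
  have := ge0_integral_addr x (measurable_funepos mf) (fun t => funepos_ge0 f t).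
  by move=> <-; apply: eq_integral => t _; rewrite !funeposE.
have := ge0_integral_addr x (measurable_funeneg mf) (fun t => funeneg_ge0 f t).
by move=> <-; apply: eq_integral => t _; rewrite !funenegE.
Qed.

Lemma Rintegral_addr (f : M -> R) (x : M) : measurable_fun setT f ->
  \int[mu]_t f (t + x) = \int[mu]_t f t.
Proof.
move=> mf; rewrite /Rintegral; congr fine.
by apply: (@integral_addr (EFin \o f)); exact/measurable_EFinP.
Qed.

Lemma cintegral_addr (f : M -> R[i]) (x : M) : cmeasurable f ->
  cintegral mu (fun t : M => f (t + x : M)) = cintegral mu f.
Proof.
move=> [mr mi]; rewrite /cintegral.
by rewrite (Rintegral_addr x mr) (Rintegral_addr x mi).
Qed.

Lemma cmeasurableM (f g : M -> R[i]) : cmeasurable f -> cmeasurable g ->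
  cmeasurable (fun t => f t * g t).
Proof.
move=> [fr fi] [gr gi]; split.
  rewrite (_ : (fun t => _) = fun t => complex.Re (f t) * complex.Re (g t)
    - complex.Im (f t) * complex.Im (g t)).
    by apply: measurable_funB; apply: measurable_funM.
  by apply/funext => t; case: (f t) (g t) => ? ? [].
rewrite (_ : (fun t => _) = fun t => complex.Re (f t) * complex.Im (g t)
  + complex.Im (f t) * complex.Re (g t)).
  by apply: measurable_funD; apply: measurable_funM.
by apply/funext => t; case: (f t) (g t) => ? ? [].
Qed.

Lemma cmeasurable_addr (f : M -> R[i]) (x : M) : cmeasurable f ->
  cmeasurable (fun t : M => f (t + x : M)).
Proof.
move=> [mr mi]; split; [exact: (measurableT_comp mr (measurable_addrM x))|
  exact: (measurableT_comp mi (measurable_addrM x))].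
Qed.

(** The p-adic factor is locally constant and the real factor is continuous. *)
Lemma cmeasurable_chi (z : M) : cmeasurable (fun t => chi t z).
Proof.
apply: (@cmeasurableM (fun t : M => expp R (t.1 * z.1 * y))
  (fun t : M => expi2pi (t.2 * z.2 / alpha0))).
  have near_e (h : R[i] -> R) (x : Qp) :
      \forall s \near x, h (expp R (s * z.1 * y)) = h (expp R (x * z.1 * y)).
    by apply: filterS (Qp_near_expp R (z.1 * y) x) => s; rewrite -!mulrA => ->.
  by split; [apply: (measurable_fun_fst (f := fun s => complex.Re (expp R (s * z.1 * y))))|
    apply: (measurable_fun_fst (f := fun s => complex.Im (expp R (s * z.1 * y))))];
    exact: near_e.
have lin : measurable_fun setT (fun u : R => 2 * pi * (u * z.2 / alpha0)).
  by apply: measurable_funM => //; apply: measurable_funM => //; apply: measurable_funM.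
split.
  apply: (measurable_fun_snd (f := fun u => cos (2 * pi * (u * z.2 / alpha0)))).
  apply: (measurableT_comp _ lin); apply: continuous_measurable_fun; exact: continuous_cos.
apply: (measurable_fun_snd (f := fun u => sin (2 * pi * (u * z.2 / alpha0)))).
apply: (measurableT_comp _ lin); apply: continuous_measurable_fun; exact: continuous_sin.
Qed.

Local Notation funW := (funW alpha0 y).

Lemma cmeasurable_funW z f : cmeasurable f -> cmeasurable (funW z f).
Proof.
move=> mf; apply: cmeasurableM; last exact: cmeasurable_addr.
exact: (cmeasurable_addr _ (cmeasurable_chi _)).
Qed.

Lemma sqnorm_funW z f : cmeasurable f -> sqnorm mu (funW z f) = sqnorm mu f.
Proof.
move=> mf; rewrite /sqnorm.
rewrite -(@ge0_integral_addr (fun t => (sqnormc (f t))%:E) (- z.1)).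
- by apply: eq_integral => t _; rewrite /funW sqnormcM sqnormc_chi mul1r.
- exact: measurable_sqnormc.
- by move=> t; rewrite lee_fin sqnormc_ge0.
Qed.

Lemma funW_sqint z f : f \in sqint_pred mu -> funW z f \in sqint_pred mu.
Proof.
move=> /sqint_predP[mf fi]; apply/sqint_predP; split; first exact: cmeasurable_funW.
by rewrite -[X in (X < _)%E]/(sqnorm mu _) sqnorm_funW.
Qed.

Lemma funWZD z c f g :
  funW z (fun t => c * f t + g t) = fun t => c * funW z f t + funW z g t.
Proof. by apply/funext => t; rewrite /funW; ring. Qed.

Lemma eq0_L2_sqnorm (F : L2 mu) : F = 0 -> L2_sqnorm F = 0%E.
Proof.
move=> ->; rewrite -L2_class0 -toL2_val L2_sqnorm_toL2; last exact: valP.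
by apply: integral0_eq => t _; rewrite /sqnormc/= expr0n addr0.
Qed.

Local Notation W := (@weyl R p p_prime alpha0 y mu).

(** [funW z] is linear and preserves the squared norm, so it sends the difference of two
    representatives, which has norm 0, to a function of norm 0. *)
Lemma weyl_toL2 z f : f \in sqint_pred mu -> W z (toL2 mu f) = toL2 mu (funW z f).
Proof.
move=> fP; rewrite /weyl; set g := L2_repr _.
have gP : (g : M -> R[i]) \in sqint_pred mu := valP g.
apply/eqP; rewrite -subr_eq0 addrC -scaleN1r -toL2ZD ?funW_sqint//; apply/eqP.
apply: L2_sqnorm_eq0; rewrite L2_sqnorm_toL2 ?sqintZD ?funW_sqint//.
rewrite -funWZD sqnorm_funW; last exact: sqint_measurable (sqintZD _ fP gP).
rewrite -L2_sqnorm_toL2 ?sqintZD// toL2ZD// scaleN1r.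
by rewrite toL2_repr addNr eq0_L2_sqnorm.
Qed.

Lemma weyl_linear z a F G : W z (a *: F + G) = a *: W z F + W z G.
Proof.
rewrite -(toL2_repr F) -(toL2_repr G); set f := L2_repr F; set g := L2_repr G.
have fP : (f : M -> R[i]) \in sqint_pred mu := valP f.
have gP : (g : M -> R[i]) \in sqint_pred mu := valP g.
rewrite -toL2ZD// !weyl_toL2 ?sqintZD// funWZD toL2ZD ?funW_sqint//.
Qed.

Lemma weyl_sqnorm z F : L2_sqnorm (W z F) = L2_sqnorm F.
Proof.
have FP : (L2_repr F : M -> R[i]) \in sqint_pred mu := valP _.
rewrite /weyl L2_sqnorm_toL2 ?funW_sqint// sqnorm_funW//.
exact: (sqint_measurable FP).
Qed.

End weyl_theory.

(** * Pointwise intertwining identities for L_r, D and J *)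

Section intertwining_identities.
Variables (R : realType) (p : nat) (p_prime : prime p).
Local Notation M := (QpR R p_prime).
Local Notation Qp := (Qp p_prime).
Implicit Types (x xi t s : M) (a b : rat).

Lemma scaleMDr a s t : scaleM a (s + t) = scaleM a s + scaleM a t.
Proof. by rewrite /scaleM !mulrDr. Qed.

Lemma scaleMDl a b t : scaleM (a + b) t = scaleM a t + scaleM b t.
Proof. by rewrite /scaleM ratr_QpD rmorphD/= !mulrDl. Qed.

Lemma scaleMN a t : scaleM a (- t) = - scaleM a t.
Proof. by rewrite /scaleM !mulrN. Qed.

Lemma scaleNM a t : scaleM (- a) t = - scaleM a t.
Proof. by rewrite /scaleM ratr_QpN rmorphN/= !mulNr. Qed.

Lemma scaleMA a b t : scaleM a (scaleM b t) = scaleM (a * b) t.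
Proof. by rewrite /scaleM ratr_QpM rmorphM/= !mulrA. Qed.

Lemma scale0M t : scaleM 0 t = 0.
Proof. by rewrite /scaleM ratr_Qp0 rmorph0 !mul0r. Qed.

Lemma scale1M t : scaleM 1 t = t.
Proof. by case: t => t1 t2; rewrite /scaleM ratr_Qp1 rmorph1 !mul1r. Qed.

Lemma scale_half t : scaleM (1 / 2) t + scaleM (1 / 2) t = t.
Proof. by rewrite -scaleMDl -splitr scale1M. Qed.

Variables (alpha0 : R) (y : Qp).
Local Notation chi := (chi alpha0 y).
Local Notation funW := (funW alpha0 y).

Lemma chiNN s t : chi (- s) (- t) = chi s t.
Proof. by rewrite chiNr opprK. Qed.

Lemma chiNl_mul s t : chi (- s) t * chi s t = 1.
Proof. by rewrite -chiDl addNr chi0l. Qed.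

(** The quotient of the chirp at t by the chirp at t - x is chi(t - x/2, rx), since r t^2 / 2 - r (t
    - x)^2 / 2 = r x (t - x/2); the half shift of the Weyl operator matches it exactly. *)
Lemma funW_funL (r : Zinvp p) x xi (f : M -> R[i]) :
  funL alpha0 y r (funW (x, xi) f) =
  funW (x, xi + scaleM (val r) x) (funL alpha0 y r f).
Proof.
apply/funext => t; rewrite /funL /funW/=; set h := scaleM (1 / 2) x.
set a : rat := val r / 2.
have -> : scaleM (val r) x = scaleM a x + scaleM a x by rewrite -scaleMDl -splitr.
rewrite [LHS]mulrA [RHS]mulrA; congr (_ * _).
rewrite scaleMDr scaleMN -/a !(chiDr _ _ _ _ (t - h)) (chiDl _ _ _ _ (scaleM a x)).
rewrite (chiDl _ _ t (- x)) (chiDr _ _ _ _ t) (chiDr _ _ _ _ (- x)).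
have -> : chi (- x) (scaleM a t) = chi (- t) (scaleM a x).
  by rewrite -chiZ chiC scaleMN chiNr.
have hB : chi (- h) (scaleM a x) * chi (- h) (scaleM a x) = chi (- x) (scaleM a x).
  by rewrite -chiDl -opprD scale_half.
have tA := chiNl_mul t (scaleM a x); have xB := chiNl_mul x (scaleM a x).
rewrite chiNr chiNN.
move: hB tA xB; set A := chi t _; set A' := chi (- t) _; set B := chi x _.
set B' := chi (- x) _; set H := chi (- h) _; set X := chi (t - h) xi; set C := chi t _.
move=> hB tA xB.
have -> : X * (A * H * (A * H)) * (C * A' * (A' * B)) =
  C * X * ((A' * A) * (A' * A) * (H * H * B)) by ring.
by rewrite hB xB tA !mulr1.
Qed.

(** [chiZ] moves the factor 1/p from the argument to xi, while rescaling t turns the translation by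
    x into one by px. *)
Lemma funW_funD x xi (f : M -> R[i]) :
  funD (funW (x, xi) f) =
  funW (scaleM p%:R x, scaleM p%:R^-1 xi) (funD f).
Proof.
have p0 : p%:R != 0 :> rat by rewrite pnatr_eq0 -lt0n prime_gt0.
have divp t : (t.1 / p%:R, t.2 / p%:R) = scaleM p%:R^-1 t.
  have eR : ratr p%:R^-1 = p%:R^-1 :> R by rewrite fmorphV/= ratr_nat.
  have eQ : ratr p%:R^-1 = p%:R^-1 :> Qp by rewrite ratr_QpV ratr_Qp_nat.
  by rewrite /scaleM eR eQ (mulrC t.1) (mulrC t.2).
have funDE (g : M -> R[i]) t : funD g t = g (scaleM p%:R^-1 t).
  by rewrite /funD divp.
apply/funext => t; rewrite funDE /funW /= funDE -chiZ.
have scaleMVM t' : scaleM p%:R^-1 (scaleM p%:R t') = t'.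
  by rewrite scaleMA mulVf// scale1M.
have -> : scaleM p%:R^-1 (t - scaleM p%:R x) = scaleM p%:R^-1 t - x.
  by rewrite scaleMDr scaleMN scaleMVM.
have -> : scaleM p%:R^-1 (t - scaleM (1 / 2) (scaleM p%:R x)) =
    scaleM p%:R^-1 t - scaleM (1 / 2) x.
  rewrite scaleMDr scaleMN; congr (_ - _).
  by rewrite scaleMA [_ * (1 / 2)]mulrC -scaleMA scaleMVM.
by [].
Qed.

(** * The Fourier transform exchanges translation and modulation *)

Section fourier.
Variable mu : {measure set M -> \bar R}.
Hypothesis mu_haar : haar_measure mu.

Definition cintegrable (f : M -> R[i]) :=
  mu.-integrable setT (fun t => (complex.Re (f t))%:E) /\
  mu.-integrable setT (fun t => (complex.Im (f t))%:E).

Lemma cintegralZ (c : R[i]) f : cintegrable f ->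
  cintegral mu (fun t => c * f t) = c * cintegral mu f.
Proof.
move=> [fr fi]; case: c => a b; rewrite /cintegral.
rewrite (_ : (fun t => complex.Re _) =
  fun t => a * complex.Re (f t) - b * complex.Im (f t)); last first.
  by apply/funext => t; case: (f t).
rewrite (_ : (fun t => complex.Im _) =
  fun t => a * complex.Im (f t) + b * complex.Re (f t)); last first.
  by apply/funext => t; case: (f t).
rewrite RintegralB// ?RintegralD// ?RintegralZl//.
- exact: (integrableZl measurableT a fi).
- exact: (integrableZl measurableT b fr).
- exact: (integrableZl measurableT a fr).
- exact: (integrableZl measurableT b fi).
Qed.

(** The substitution of h - x for h turns one integrand into the other. Integrability serves to
    bring the outer phase under the integral sign. *)
Lemma funW_funJ x xi (f : M -> R[i]) : cmeasurable f ->
  (forall t, cintegrable (fun h => (chi h t)^*%C * f h)) ->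
  funJ alpha0 y mu (funW (x, xi) f) = funW (xi, - x) (funJ alpha0 y mu f).
Proof.
move=> mf fi; apply/funext => t.
(* [K] is the right-hand integrand with its phase absorbed; the left-hand integrand is [K] at h -
   x. *)
pose K h := chi (t - scaleM (1 / 2) xi) (- x) * ((chi h (t - xi))^*%C * f h).
have mK : cmeasurable K.
  apply: cmeasurableM; first by split; exact: measurable_cst.
  apply: cmeasurableM => //.
  rewrite (_ : (fun h => _) = fun h => chi h (- (t - xi))); first exact: cmeasurable_chi.
  by apply/funext => h; rewrite chi_conj chiNr.
have -> : funW (xi, - x) (funJ alpha0 y mu f) t = cintegral mu K.
  by rewrite (cintegralZ _ (fi (t - xi))).
rewrite -(cintegral_addr mu_haar (- x) mK) /funJ.
congr (cintegral mu _); apply/funext => h; rewrite /K /funW [LHS]mulrA [RHS]mulrA; congr (_ * _).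
rewrite !chi_conj; set hx := scaleM (1 / 2) x; set hxi := scaleM (1 / 2) xi.
(* The constant chi(x/2, xi) from the outer phase and chi(-x, xi) from the translated kernel combine
   to chi(-x/2, xi), the half shift on the left. *)
have e1 : chi (- hxi) (- x) = chi hx xi by rewrite chiNN chiZ chiC.
have e2 : chi hx xi * chi (- x) xi = chi (- hx) xi.
  by rewrite -chiDl -[in - x](scale_half x) opprD addrA subrr add0r.
have e3 : chi t (- x) * chi x t = 1 by rewrite (chiC _ _ x) -chiDr addNr chiC chi0l.
rewrite opprB (chiDl _ _ t (- hxi)) e1 (chiDl _ _ h (- hx)) -e2.
rewrite (chiDl _ _ x (- h)) (chiDr _ _ _ _ x) (chiDr _ _ _ _ (- h)) chiNN.
rewrite (chiNr _ _ x xi).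
move: (chi (- h) t) (chi h xi) (chi hx xi) (chi (- x) xi) e3 => a b c d.
set u := chi t _; set v := chi x t => e3.
have -> : u * c * (v * d * (a * b)) = (u * v) * (a * (b * (c * d))) by ring.
by rewrite e3 mul1r.
Qed.

End fourier.
End intertwining_identities.

(** * Bruhat-Schwartz test functions and bumps over rectangles *)

Section test_functions.
Variables (R : realType) (p : nat) (p_prime : prime p).
Local Notation M := (QpR R p_prime).
Local Notation Qp := (Qp p_prime).
Implicit Types (t : M) (a b : R) (S : set Qp).

Lemma locally_constant_addr (phi : Qp -> R[i]) (c : Qp) :
  locally_constant phi -> locally_constant (fun s => phi (s + c)).
Proof. by move=> lc s; exact: (@Qp_continuousD _ _ c s _ (lc (s + c))). Qed.

Lemma locally_constantM (phi psi : Qp -> R[i]) :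
  locally_constant phi -> locally_constant psi ->
  locally_constant (fun s => phi s * psi s).
Proof. by move=> lp lq s; apply: filterS2 (lp s) (lq s) => z -> ->. Qed.

Lemma locally_constant_expp (c : Qp) : locally_constant (fun s : Qp => expp R (s * c)).
Proof. by move=> s; exact: Qp_near_expp. Qed.

Lemma ball_compactly_supported (phi : Qp -> R[i]) c (e : rat) : 0 < e ->
  (forall s, phi s != 0 -> ball c e s) -> compactly_supported phi.
Proof.
move=> e0 pe; rewrite /compactly_supported.
apply: (@subclosed_compact _ _ (ball c e)); last 2 first.
- exact: Qp_compact_ball.
- rewrite [X in _ `<=` X](closure_id (ball c e)).1; last exact: Qp_closed_ball.
  by apply: closure_subset => s; exact: pe.
exact: closed_closure.
Qed.

(** Pure tensors with bounded supports in both variables: Bruhat-Schwartz, stable under Weyl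
    operators, and rich enough to contain the bumps. Support is recorded by a ball so that
    translation only moves its centre. *)
Definition test_function (f : M -> R[i]) : Prop :=
  exists (phi : Qp -> R[i]) (g : R -> R[i]),
  [/\ locally_constant phi,
      exists (c : Qp) (e : rat), 0 < e /\ forall s, phi s != 0 -> ball c e s,
      smooth (fun u => complex.Re (g u)) /\ smooth (fun u => complex.Im (g u)),
      exists A : R, forall u, A < `|u| -> g u = 0 &
      forall t, f t = phi t.1 * g t.2].

Lemma test_function_schwartz f : test_function f -> schwartz_bruhat f.
Proof.
move=> [phi [g [lc [c [e [e0 ce]]] [sr si] [A gA] fE]]].
exists 1%N, (fun=> phi), (fun=> g); split.
- by move=> _; split => //; exact: ball_compactly_supported ce.
- by move=> _; split; apply: (@schwartz_real_compact_support _ _ A) => // u /gA->.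
- by move=> t; rewrite big_ord1.
Qed.

(** chi splits into e_p, locally constant, and e, smooth, so the operator acts on each tensor
    factor. This is needed because U is prescribed only on Bruhat-Schwartz functions and must also
    be evaluated after W. *)
Lemma test_function_funW (alpha0 : R) (y : Qp) z f :
  test_function f -> test_function (funW alpha0 y z f).
Proof.
move=> [phi [g [lc [c [e [e0 ce]]] [sr si] [A gA] fE]]].
set h := scaleM (1 / 2) z.1.
exists (fun s => expp R ((s - h.1) * (z.2.1 * y)) * phi (s - z.1.1)).
exists (fun u => expi2pi ((u - h.2) * z.2.2 / alpha0) * g (u - z.1.2)).
pose k : R := 2 * pi * (z.2.2 / alpha0).
have affE (F : R -> R) : (fun u => F (2 * pi * ((u - h.2) * z.2.2 / alpha0))) =
    (fun u => F (k * u + - (k * h.2))).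
  by apply/funext => u; congr F; rewrite /k; ring.
have sc : smooth (fun u => cos (2 * pi * ((u - h.2) * z.2.2 / alpha0))).
  by rewrite affE => n; apply: Cdiff_affine; case: (Cdiff_trig R n).
have ss : smooth (fun u => sin (2 * pi * ((u - h.2) * z.2.2 / alpha0))).
  by rewrite affE => n; apply: Cdiff_affine; case: (Cdiff_trig R n).
have shift (F : R -> R) : smooth F -> smooth (fun u => F (u - z.1.2)).
  move=> sF n; have := Cdiff_affine 1 (- z.1.2) (sF n).
  by under eq_fun do rewrite mul1r.
have {}sr := shift _ sr; have {}si := shift _ si.
split.
- apply: locally_constantM; last exact: locally_constant_addr.
  exact: (@locally_constant_addr (fun s => expp R (s * (z.2.1 * y))) _
    (locally_constant_expp _)).
- exists (c + z.1.1), e; split => // s; rewrite mulf_eq0 negb_or => /andP[_ /ce].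
  rewrite !Qp_ballE => ces; rewrite (_ : c + z.1.1 - s = c - (s - z.1.1)); first exact: ces.
  by rewrite opprB addrA.
- split.
    rewrite (_ : (fun u => _) = fun u =>
      cos (2 * pi * ((u - h.2) * z.2.2 / alpha0)) * complex.Re (g (u - z.1.2)) +
      -1 * (sin (2 * pi * ((u - h.2) * z.2.2 / alpha0)) * complex.Im (g (u - z.1.2)))).
      by move=> n; apply: CdiffD; [apply: CdiffM|apply: CdiffZ; apply: CdiffM].
    by apply/funext => u; rewrite mulN1r; case: (g _).
  rewrite (_ : (fun u => _) = fun u =>
      cos (2 * pi * ((u - h.2) * z.2.2 / alpha0)) * complex.Im (g (u - z.1.2)) +
      sin (2 * pi * ((u - h.2) * z.2.2 / alpha0)) * complex.Re (g (u - z.1.2))).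
    by move=> n; apply: CdiffD; apply: CdiffM.
  by apply/funext => u; case: (g _).
- exists (A + `|z.1.2|) => u Au; rewrite gA ?mulr0//.
  by rewrite -(ltrD2r `|z.1.2|) (lt_le_trans Au)// -{1}(subrK z.1.2 u) ler_normD.
- move=> t; rewrite /funW fE /chi -/h /= -!mulrA; congr (_ * _).
  by rewrite mulrCA.
Qed.

Definition bump_rect S a b n : M -> R := fun t => \1_S t.1 * bump a b n t.2.

Lemma bump_rect_ge0 S a b n t : 0 <= bump_rect S a b n t.
Proof. by rewrite mulr_ge0 ?bump_ge0// indicE. Qed.

Lemma bump_rect_le S a b n t : bump_rect S a b n t <= \1_(rect S a b) t.
Proof.
rewrite /bump_rect !indicE; case: (boolP (t.1 \in S)) => St; last by rewrite mul0r.
rewrite mul1r; have [/idP ab|ab] := boolP (a < t.2 < b).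
  by rewrite mem_set ?bump_le1//; split => //; exact: set_mem.
by rewrite bump_eq0.
Qed.

Lemma locally_constant_indic S : open S -> closed S ->
  locally_constant (fun s : Qp => Complex (\1_S s : R) 0).
Proof.
move=> So Sc s; have [Ss|nSs] := pselect (S s).
  have : nbhs s S by apply: open_nbhs_nbhs.
  by apply: filterS => u Su; rewrite !indicE !mem_set.
have : nbhs s (~` S) by apply: open_nbhs_nbhs; split => //; exact: closed_openC.
by apply: filterS => u Su; rewrite !indicE !memNset.
Qed.

Lemma test_function_bump_rect S a b n : open S -> closed S ->
  (exists2 e : rat, 0 < e & S `<=` ball (0 : Qp) e) ->
  test_function (realc (bump_rect S a b n)).
Proof.
move=> So Sc [e e0 Se].
exists (fun s => Complex (\1_S s : R) 0), (fun u => Complex (bump a b n u) 0); split.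
- exact: locally_constant_indic.
- exists 0, e; split => // s; rewrite indicE.
  by have [/set_mem/Se //|_] := boolP (s \in S); rewrite eqxx.
- split; first exact: smooth_bump.
  by move=> k; exact: Cdiff_cst.
- exists (Num.max `|a| `|b|) => u; rewrite gt_max => /andP[ua ub].
  rewrite bump_eq0//; apply/negP => /andP[au ub'].
  case: (lerP 0 u) => u0.
    rewrite (ger0_norm u0) in ub.
    by have := lt_trans (le_lt_trans (ler_norm b) ub) ub'; rewrite ltxx.
  rewrite (ltr0_norm u0) in ua.
  have := ler_norm (- a); rewrite normrN => /le_lt_trans/(_ ua).
  by rewrite ltrN2 ltNge ltW.
- by move=> t; rewrite /realc /bump_rect; apply/eqP; rewrite eq_complex/= !mul0r !mulr0 subr0 addr0 !eqxx.
Qed.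

Variable mu : {measure set M -> \bar R}.
Hypothesis mu_haar : haar_measure mu.

(** The rectangle lies in the compact product of a ball and the segment [a, b]. *)
Lemma haar_rect_lty S a b : open S ->
  (exists2 e : rat, 0 < e & S `<=` ball (0 : Qp) e) -> (mu (rect S a b) < +oo)%E.
Proof.
move=> So [e e0 Se].
have [_ mu_compact _] := mu_haar.
pose K : set M := ball (0 : Qp) e `*` `[a, b].
have Kc : compact K by apply: compact_setX; [exact: Qp_compact_ball|exact: segment_compact].
apply: le_lt_trans (mu_compact K Kc); apply: le_measure; rewrite ?inE.
- by apply: open_measurable_QpR; exact: open_rect.
- rewrite -[K]setCK; apply: measurableC; apply: open_measurable_QpR; apply: closed_openC.
  have -> : K = (fst @^-1` ball (0 : Qp) e) `&` (snd @^-1` `[a, b]%classic) by [].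
  apply: closedI; apply: closed_comp.
  - by move=> t _; exact: cvg_fst.
  - exact: Qp_closed_ball.
  - by move=> t _; exact: cvg_snd.
  - exact: itv_closed.
- move=> t [/Se St /andP[at_ tb]]; split => //=.
  by rewrite in_itv/= !ltW.
Qed.

End test_functions.

(** * Integrability of the bumps and their Fourier integrands *)

Section intertwining.
Variables (R : realType) (p : nat) (p_prime : prime p).
Local Notation M := (QpR R p_prime).
Local Notation Qp := (Qp p_prime).
Variables (alpha0 : R) (y : Qp) (mu : {measure set M -> \bar R}).
Hypothesis mu_haar : haar_measure mu.
Implicit Types (S : set Qp) (a b : R).
Local Notation chi := (chi alpha0 y).
Local Notation funW := (funW alpha0 y).
Local Notation W := (@weyl R p p_prime alpha0 y mu).

Lemma smooth_measurable (f : R -> R) : smooth f -> measurable_fun setT f.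
Proof.
move=> sf; apply: continuous_measurable_fun => x.
have [f' /(_ x)[dfx _] _] := sf 1%N.
exact/differentiable_continuous/derivable1_diffP.
Qed.

Section bump_rect.
Variables (S : set Qp) (a b : R) (n : nat).
Hypotheses (S_open : open S) (S_closed : closed S).
Hypothesis S_ball : exists2 e : rat, 0 < e & S `<=` ball (0 : Qp) e.

Let f : M -> R := bump_rect S a b n.

Lemma measurable_bump_rect : measurable_fun setT f.
Proof.
apply: measurable_funM.
  apply: measurable_fun_fst => x.
  by apply: filterS (locally_constant_indic R S_open S_closed x) => z [].
by apply: measurable_fun_snd; apply: smooth_measurable; exact: smooth_bump.
Qed.

Lemma measurable_rect : measurable (rect S a b : set M).
Proof. by apply: open_measurable_QpR; exact: open_rect. Qed.

Lemma integral_rect_lty : (\int[mu]_t (\1_(rect S a b) t : R)%:E < +oo)%E.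
Proof.
rewrite integral_indic ?setIT//; first exact: haar_rect_lty.
exact: measurable_rect.
Qed.

Lemma bump_rect_sqr_le t : f t ^+ 2 <= \1_(rect S a b) t.
Proof.
apply: le_trans (bump_rect_le S a b n t); rewrite expr2 ler_piMl ?bump_rect_ge0//.
by apply: le_trans (bump_rect_le S a b n t) _; rewrite indicE; case: (_ \in _).
Qed.

Lemma bump_rect_sqint : realc f \in sqint_pred mu.
Proof.
apply: (@realc_sqint _ _ _ _ _ (\1_(rect S a b))).
- exact: measurable_bump_rect.
- by apply: measurable_indic; exact: measurable_rect.
- exact: bump_rect_sqr_le.
- exact: integral_rect_lty.
Qed.

Lemma rect_integrable (g : M -> R) : measurable_fun setT g ->
  (forall t, `|g t| <= \1_(rect S a b) t) -> mu.-integrable setT (fun t => (g t)%:E).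
Proof.
move=> mg gle; apply: (@le_integrable _ _ _ _ _ measurableT _
    (fun t => (\1_(rect S a b) t : R)%:E)).
- exact/measurable_EFinP.
- move=> t _; rewrite /= lee_fin (le_trans (gle t))// ler_norm//.
apply/integrableP; split.
  by apply/measurable_EFinP; apply: measurable_indic; exact: measurable_rect.
under eq_integral do rewrite gee0_abs ?lee_fin//.
exact: integral_rect_lty.
Qed.

(** As |chi| = 1, real and imaginary parts are bounded by the indicator of a rectangle of finite
    measure. *)
Lemma cintegrable_chi_bump_rect t :
  cintegrable mu (fun h => (chi h t)^*%C * realc f h).
Proof.
have mc : cmeasurable (fun h => (chi h t)^*%C * realc f h).
  apply: cmeasurableM.
    rewrite (_ : (fun h => _) = fun h => chi h (- t)); first exact: cmeasurable_chi.
    by apply/funext => h; rewrite chi_conj chiNr.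
  by split; [exact: measurable_bump_rect|exact: measurable_cst].
have le1 (u v : R) : u ^+ 2 + v ^+ 2 = 1 -> `|u| <= 1.
  by move=> uv; rewrite ler_norml; apply/andP; split; nra.
have bound (u v : R) h : u ^+ 2 + v ^+ 2 = 1 -> `|u * f h| <= \1_(rect S a b) h.
  move=> /le1 u1; apply: le_trans (bump_rect_le S a b n h).
  by rewrite normrM (ger0_norm (bump_rect_ge0 _ _ _ _ _)) ler_piMl ?bump_rect_ge0.
split; apply: rect_integrable; try by case: mc.
  move=> h; have := sqnormc_chi alpha0 y h t; rewrite /sqnormc.
  by case: (chi h t) => u v /= uv; rewrite mulr0 subr0 (bound _ v).
move=> h; have := sqnormc_chi alpha0 y h t; rewrite /sqnormc.
case: (chi h t) => u v /= uv; rewrite mulr0 add0r (bound _ u)//.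
by rewrite sqrrN addrC.
Qed.

End bump_rect.

(** * From bumps to all of L^2(M), for an abstract operator U *)

Section operator.
Variables (Fop : (M -> R[i]) -> M -> R[i]) (U : L2 mu -> L2 mu) (z z' : M * M).
Hypothesis U_ext : unitary_extension Fop U.
Hypothesis Fop_funW : forall S a b n, open S -> closed S ->
  (exists2 e : rat, 0 < e & S `<=` ball (0 : Qp) e) ->
  Fop (funW z (realc (bump_rect S a b n))) = funW z' (Fop (realc (bump_rect S a b n))).

Let U_linear : forall c F G, U (c *: F + G) = c *: U F + U G.
Proof. by have [[lU _ _] _] := U_ext; exact: lU. Qed.

Let U0 : U 0 = 0.
Proof. by apply: (@addrI _ (1 *: U 0)); rewrite -U_linear !scale1r !addr0. Qed.

Let W_linear w c F G : W w (c *: F + G) = c *: W w F + W w G.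
Proof. exact: weyl_linear. Qed.

Let W0 w : W w 0 = 0.
Proof. by apply: (@addrI _ (1 *: W w 0)); rewrite -W_linear !scale1r !addr0. Qed.

Let U_sqnorm F : L2_sqnorm (U F) = L2_sqnorm F.
Proof. by apply: unitary_sqnorm; have [] := U_ext. Qed.

(* If the image under Fop were not square-integrable, its junk class 0 would  *)
(* force the class of the bump itself to vanish.                              *)
Lemma intertwining_bump_rect S a b n : open S -> closed S ->
  (exists2 e : rat, 0 < e & S `<=` ball (0 : Qp) e) ->
  let F := toL2 mu (realc (bump_rect S a b n)) in U (W z F) = W z' (U F).
Proof.
move=> So Sc Se F; have fP := bump_rect_sqint a b n So Sc Se.
have tf := test_function_bump_rect a b n So Sc Se.
have [_ Uf] := U_ext.
have [F0|F0] := eqVneq F 0; first by rewrite F0 W0 U0 W0.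
have UF : U F = toL2 mu (Fop (realc (bump_rect S a b n))).
  by apply: Uf; exact: test_function_schwartz.
have FopP : Fop (realc (bump_rect S a b n)) \in sqint_pred mu.
  apply: contraT => nP; move: F0; rewrite toL2_junk// in UF.
  by rewrite [F]L2_sqnorm_eq0 ?eqxx// -U_sqnorm UF eq0_L2_sqnorm.
rewrite UF (weyl_toL2 _ _ mu_haar _ FopP) (weyl_toL2 _ _ mu_haar _ fP) -Fop_funW//.
by apply: Uf; apply: test_function_schwartz; exact: test_function_funW.
Qed.

(** [dominated_density] is applied to the equalizer of the two linear isometries, with the clopen
    rectangles as pi-system. *)
Lemma weyl_intertwining F : U (W z F) = W z' (U F).
Proof.
pose E := [set F | U (W z F) = W z' (U F)].
suff : E F by [].
have subE (A : L2 mu -> L2 mu) :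
    (forall c F G, A (c *: F + G) = c *: A F + A G) ->
    forall F G, A (F - G) = A F - A G.
  by move=> lA G H; rewrite addrC -scaleN1r lA scaleN1r addrC.
pose K n : set M := rect (ball (0 : Qp) n.+1%:R) (- n.+1%:R) n.+1%:R.
have Eclosed (H : L2 mu) : (forall e : R, 0 < e ->
    exists2 G, E G & (L2_sqnorm (H - G)%R <= e%:E)%E) -> E H.
  move=> HE; apply: (@isometry_equalizer_closed _ _ _ _
    (fun F => U (W z F)) (fun F => W z' (U F))) => //.
  - by apply: subE => c G G'; rewrite W_linear U_linear.
  - by apply: subE => c G G'; rewrite U_linear W_linear.
  - by move=> G; rewrite U_sqnorm weyl_sqnorm.
  - by move=> G; rewrite weyl_sqnorm// U_sqnorm.
have Elinear c G H : E G -> E H -> E (c *: G + H).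
  by rewrite /E/= => EG EH; rewrite W_linear !U_linear W_linear EG EH.
have GK n : @clopen_rects R p p_prime (K n).
  have n0 : 0 < n.+1%:R :> rat by [].
  exists (ball (0 : Qp) n.+1%:R), (- n.+1%:R), n.+1%:R; split => //.
  - exact: Qp_open_ball.
  - exact: Qp_closed_ball.
  - by exists n.+1%:R.
have Gmeas A : @clopen_rects R p p_prime A -> measurable A.
  by move=> [S [a [b [So _ _ ->]]]]; exact: measurable_rect.
apply: (dominated_density Elinear Eclosed (G := @clopen_rects R p p_prime) (K := K)) => //.
- exact: clopen_rects_setI.
- move=> _ [S [a [b [So Sc Se ->]]]].
  (* The bumps over a rectangle converge pointwise to its indicator, which also dominates their
     squares. *)
  apply: (@mem_real_dominated _ _ _ _ _ Eclosed (bump_rect S a b) _ (\1_(rect S a b))).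
  + by move=> n; split; [exact: bump_rect_sqint|exact: intertwining_bump_rect].
  + by apply: measurable_indic; exact: measurable_rect.
  + move=> t; rewrite (_ : \1_(rect S a b) t = \1_S t.1 * (a < t.2 < b)%R%:R).
      apply: cvgM; first exact: cvg_cst.
      exact: cvg_bump.
    rewrite !indicE -natrM mulnb; congr (_%:R); congr nat_of_bool.
    by apply/idP/andP => [/set_mem[St ab]|[/set_mem St ab]]; [split => //|]; apply/mem_set.
  + by apply: measurable_indic; exact: measurable_rect.
  + exact: integral_rect_lty.
  + by move=> n t; exact: bump_rect_sqr_le.
  + by move=> t; rewrite indicE; case: (_ \in _); rewrite ?expr1n ?expr0n.
- exact: measurable_sigma_clopen_rects.
- move=> n; have n0 : 0 < n.+1%:R :> rat by [].
  apply: haar_rect_lty => //; first exact: Qp_open_ball.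
  by exists n.+1%:R.
(* The rectangles [K n] exhaust M: n need only exceed bounds on both coordinates of t. *)
- move=> t; have := archi_boundP (pabs_ge0 t.1); set m := Num.Def.archi_bound _ => tm.
  have := archi_boundP (normr_ge0 t.2); set k := Num.Def.archi_bound _ => tk.
  exists (maxn m k) => // n /=; rewrite geq_max => /andP[mn kn]; split => /=.
    rewrite Qp_ballE sub0r pabsN; apply: (lt_le_trans tm).
    by rewrite ler_nat ltnW.
  rewrite -ltr_norml (lt_le_trans tk)// ler_nat ltnW//.
Qed.

(** U is surjective, so [op_inv U] is a right inverse and the intertwining relation can be composed
    with it. *)
Lemma weyl_conjugation : U \o W z \o op_inv U = W z'.
Proof.
apply/funext => F /=; rewrite weyl_intertwining; congr (W z' _).
have [[_ [V _ VK] _] _] := U_ext.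
by rewrite /op_inv pinvK//; apply/mem_set; exists (V F).
Qed.

End operator.
End intertwining.

Theorem proposition5p5 (R : realType) (p : nat) (p_prime : prime p)
    (p_odd : odd p) (alpha0 : R) (alpha0_neq0 : alpha0 != 0)
    (y : Qp p_prime) (y_neq0 : y != 0)
    (mu : {measure set (QpR R p_prime) -> \bar R})
    (mu_haar : haar_measure mu) (mu_self_dual : self_dual alpha0 y mu)
    (SJ : L2 mu -> L2 mu)
    (SJ_ext : unitary_extension (funJ alpha0 y mu) SJ)
    (SL : Zinvp p -> L2 mu -> L2 mu)
    (SL_ext : forall r, unitary_extension (funL alpha0 y r) (SL r))
    (SD : L2 mu -> L2 mu)
    (SD_ext : unitary_extension (@funD R p p_prime) SD)
    (W := @weyl R p p_prime alpha0 y mu) :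
  forall (x xi : QpR R p_prime) (r : Zinvp p),
    [/\ SJ \o W (x, xi) \o op_inv SJ = W (xi, - x) /\
        W (xi, - x) = W (mxact (mxJ p) (x, xi)),
        SL r \o W (x, xi) \o op_inv (SL r) = W (x, xi + scaleM (val r) x) /\
        W (x, xi + scaleM (val r) x) = W (mxact (mxL r) (x, xi)) &
        SD \o W (x, xi) \o op_inv SD = W (scaleM p%:R x, scaleM p%:R^-1 xi) /\
        W (scaleM p%:R x, scaleM p%:R^-1 xi) = W (mxact (mxD p) (x, xi))].
Proof.
move=> x xi r.
have mxactE a b c d (s t : QpR R p_prime) : mxact (mx2 a b c d) (s, t) =
    (scaleM (val a) s + scaleM (val b) t, scaleM (val c) s + scaleM (val d) t).
  by rewrite /mxact !mxE.
have v0 : val (0 : Zinvp p) = 0 by rewrite rmorph0.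
have v1 : val (1 : Zinvp p) = 1 by rewrite rmorph1.
split.
- split; last first.
    by rewrite mxactE rmorphN1 v0 v1 scaleNM !scale0M !scale1M add0r addr0.
  apply: (weyl_conjugation mu_haar SJ_ext) => S a b n So Sc Se.
  (* Unlike the identities for L_r and D, the one for J involves an integral, hence the
     integrability of the bump against every character. *)
  apply: funW_funJ => //; last exact: cintegrable_chi_bump_rect.
  exact: sqint_measurable (bump_rect_sqint mu_haar a b n So Sc Se).
- split; last by rewrite mxactE v0 v1 scale0M !scale1M addr0 addrC.
  by apply: (weyl_conjugation mu_haar (SL_ext r)) => *; exact: funW_funL.
- split; last by rewrite mxactE v0 rmorph_nat !scale0M addr0 add0r.
  by apply: (weyl_conjugation mu_haar SD_ext) => *; exact: funW_funD.
Qed.
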